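(* Let $P=\Bbbk[u_1,u_2]$ be a filtered quadratic Poisson algebra with a nontrivial Poisson bracket. Suppose $H$ is a finite-dimensional Hopf algebra that acts on $P$ (i.e. $P$ is an $H$-module Poisson algebra) while preserving the filtration. Then the action of $H$ on $P$ factors through a group algebra.
   Context: $\Bbbk$ is an algebraically closed field of characteristic zero; all algebras are $\Bbbk$-algebras. A Poisson algebra is a commutative algebra $A$ with a bilinear bracket $\{-,-\}$ such that $(A,\{-,-\})$ is a Lie algebra and each $\{a,-\}$ is a derivation of $A$. Sumless Sweedler notation is used: $\Delta(h)=h_1\otimes h_2$ (summation understood). A Poisson algebra $A$ is an $H$-module Poisson algebra if it is a left $H$-module with $h\cdot 1_A=\epsilon(h)1_A$, $h\cdot(ab)=(h_1\cdot a)(h_2\cdot b)$ and $h\cdot\{a,b\}=\{h_1\cdot a,h_2\cdot b\}$ for all $h\in H$, $a,b\in A$. An action of $H$ on $A$ factors through a group algebra if there is a Hopf ideal $I$ of $H$ with $I\cdot A=0$ and $H/I$ isomorphic, as a Hopf algebra, to a group algebra. For a Poisson polynomial algebra $P=\Bbbk[u_1,\ldots,u_n]$, let $F_kP$ be the space of polynomials of total degree at most $k$ (each $u_i$ having degree $1$). $P$ is filtered quadratic if $\{u_i,u_j\}\in F_2P$ for all $i,j$. The action preserves the filtration if each $F_kP$ is an $H$-submodule. *)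

(* Defs.v *)
From HB Require Import structures.
From mathcomp Require Import all_boot all_order all_fingroup all_algebra all_field.
From mathcomp Require Import mpoly.

Set Implicit Arguments.
Unset Strict Implicit.
Unset Printing Implicit Defensive.

Import GRing.Theory.
Local Open Scope ring_scope.

Local Notation bilin B := (bilinear_for *:%R *:%R B).

Section LinearPredicate.
Variables (k : fieldType) (U W : lmodType k) (f : U -> W).
Hypothesis fL : linear f.

Let g : {linear U -> W} := HB.pack f (GRing.isLinear.Build k U W *:%R f fL).

Lemma lin0 : f 0 = 0. Proof. exact: (linear0 g). Qed.
Lemma linD : {morph f : x y / x + y}. Proof. exact: (linearD g). Qed.
Lemma linB : {morph f : x y / x - y}. Proof. exact: (linearB g). Qed.
Lemma linZ c : {morph f : x / c *: x}. Proof. exact: (linearZ_LR g). Qed.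
Lemma lin_sum (I : Type) (r : seq I) (P : pred I) (F : I -> U) :
  f (\sum_(i <- r | P i) F i) = \sum_(i <- r | P i) f (F i).
Proof. exact: (linear_sum g). Qed.

End LinearPredicate.

(* The tensor product of two finite-dimensional spaces is realised by matrices
   of coordinates with respect to the canonical bases [vbasis {:U}] and
   [vbasis {:V}].  It is an alias so that square matrices do not bring their
   ring structure along. *)
Definition tens (k : fieldType) (U V : vectType k) : predArgType :=
  'M[k]_(\dim {:U}, \dim {:V}).

HB.instance Definition _ (k : fieldType) (U V : vectType k) :=
  Vector.copy (tens U V) 'M[k]_(\dim {:U}, \dim {:V}).

Section Tensor.
Variables (k : fieldType) (U V : vectType k).

Definition tpure (u : U) (v : V) : tens U V :=
  \matrix_(i, j) (coord (vbasis {:U}) i u * coord (vbasis {:V}) j v).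

(* The value at [t = \sum u_i (x) v_i] of the linear map induced by a bilinear
   [B], namely [\sum B u_i v_i]; see [tlift_tpure] and [tlift_is_linear]. *)
Definition tlift (W : lmodType k) (B : U -> V -> W) (t : tens U V) : W :=
  \sum_i \sum_j (t : 'M_(_, _)) i j *: B (vbasis {:U})`_i (vbasis {:V})`_j.

Definition tens_space (A : {vspace U}) (B : {vspace V}) : {vspace tens U V} :=
  <<[seq tpure a b | a <- vbasis A, b <- vbasis B]>>%VS.

Lemma tpure_bilin : bilin tpure.
Proof.
split=> [v c x y|u c x y]; apply/matrixP=> i j; rewrite !mxE linearP /=.
  by rewrite mulrDl mulrA.
by rewrite mulrDr mulrCA.
Qed.

Lemma tlift_is_linear (W : lmodType k) (B : U -> V -> W) : linear (tlift B).
Proof.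
move=> c s t; rewrite /tlift scaler_sumr -big_split; apply: eq_bigr => i _ /=.
rewrite scaler_sumr -big_split; apply: eq_bigr => j _ /=.
by rewrite !mxE scalerDl scalerA.
Qed.

HB.instance Definition _ (W : lmodType k) (B : U -> V -> W) :=
  GRing.isLinear.Build k (tens U V) W *:%R (tlift B) (tlift_is_linear B).

Lemma eq_tlift (W : lmodType k) (B C : U -> V -> W) t :
  (forall u v, B u v = C u v) -> tlift B t = tlift C t.
Proof. by move=> eqBC; apply: eq_bigr => i _; apply: eq_bigr => j _; rewrite eqBC. Qed.

Lemma tlift_comp (W W' : lmodType k) (f : W -> W') (B : U -> V -> W) t :
  linear f -> f (tlift B t) = tlift (fun u v => f (B u v)) t.
Proof.
move=> fL; rewrite /tlift (lin_sum fL); apply: eq_bigr => i _ /=.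
by rewrite (lin_sum fL); apply: eq_bigr => j _; rewrite (linZ fL).
Qed.

Lemma tlift_param (X W : lmodType k) (F : X -> U -> V -> W) t :
  (forall u v, linear (fun x => F x u v)) -> linear (fun x => tlift (F x) t).
Proof.
move=> FL c x y; rewrite /tlift scaler_sumr -big_split; apply: eq_bigr => i _ /=.
rewrite scaler_sumr -big_split; apply: eq_bigr => j _ /=.
by rewrite FL scalerDr !scalerA [c * _]mulrC.
Qed.

Lemma tlift_tpure (W : lmodType k) (B : U -> V -> W) u v :
  bilin B -> tlift B (tpure u v) = B u v.
Proof.
move=> [Bl Br]; rewrite [u in RHS](coord_vbasis (memvf u)) (lin_sum (Bl v)).
apply: eq_bigr => i _; rewrite (linZ (Bl v)).
rewrite [v in RHS](coord_vbasis (memvf v)) (lin_sum (Br _)) scaler_sumr.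
by apply: eq_bigr => j _; rewrite (linZ (Br _)) scalerA !mxE.
Qed.

Lemma tlift_id t : tlift tpure t = t.
Proof.
apply/matrixP=> a b; rewrite /tlift summxE (bigD1 a) //= summxE (bigD1 b) //=.
have E (T : vectType k) (i j : 'I_(\dim {:T})) :
    coord (vbasis {:T}) i (vbasis {:T})`_j = (j == i)%:R.
  by rewrite coord_free ?(basis_free (vbasisP _)).
rewrite !mxE !E !eqxx !mulr1 !big1 ?addr0 // => [i ia|j jb].
  rewrite summxE big1 // => j _; rewrite !mxE !E (negPf ia).
  by rewrite mul0r mulr0.
by rewrite !mxE !E (negPf jb) !mulr0.
Qed.

Lemma tens_ext (W : lmodType k) (f g : tens U V -> W) :
  linear f -> linear g ->
  (forall u v, f (tpure u v) = g (tpure u v)) -> f =1 g.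
Proof.
move=> fL gL fg t; rewrite -[t]tlift_id (tlift_comp _ _ fL) (tlift_comp _ _ gL).
exact: eq_tlift.
Qed.

Lemma tpure_space (A : {vspace U}) (B : {vspace V}) a b :
  a \in A -> b \in B -> tpure a b \in tens_space A B.
Proof.
move=> aA bB; rewrite (coord_vbasis aA) (coord_vbasis bB).
rewrite (lin_sum (tpure_bilin.1 _)) memv_suml // => i _.
rewrite (linZ (tpure_bilin.1 _)) memvZ // (lin_sum (tpure_bilin.2 _)).
rewrite memv_suml // => j _; rewrite (linZ (tpure_bilin.2 _)) memvZ //.
by apply/memv_span/allpairs_f; rewrite mem_nth // size_tuple.
Qed.

Lemma tens_space0 (W : lmodType k) (A : {vspace U}) (B : {vspace V})
    (f : tens U V -> W) t : linear f ->
  (forall a b, a \in A -> b \in B -> f (tpure a b) = 0) ->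
  t \in tens_space A B -> f t = 0.
Proof.
move=> fL f0; rewrite /tens_space; set s := [seq _ | a <- _, b <- _].
move/(@coord_span _ _ _ (in_tuple s)) => ->; rewrite (lin_sum fL) big1 // => i _.
have /allpairsP[[a b] /= [aA bB sE]] : s`_i \in s by rewrite mem_nth.
by rewrite (linZ fL) /= sE f0 ?scaler0 // vbasis_mem.
Qed.

End Tensor.

Definition tmap (k : fieldType) (U V U' V' : vectType k)
    (f : U -> U') (g : V -> V') : tens U V -> tens U' V' :=
  tlift (fun u v => tpure (f u) (g v)).

HB.mixin Record Falgebra_isHopf (k : fieldType) H of Falgebra k H := {
  comul : {linear H -> tens H H};
  counit : {scalar H};
  antipode : {linear H -> H};
  comulA : forall h : H,
    tlift (fun h1 h2 => tlift (fun x y => tpure x (tpure y h2)) (comul h1))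
      (comul h)
    = tlift (fun h1 h2 => tpure h1 (comul h2)) (comul h);
  counitl : forall h : H, tlift (fun h1 h2 => counit h1 *: h2) (comul h) = h;
  counitr : forall h : H, tlift (fun h1 h2 => counit h2 *: h1) (comul h) = h;
  comul1 : comul 1 = tpure 1 1;
  comulM : forall g h : H,
    comul (g * h) =
    tlift (fun g1 g2 => tlift (fun h1 h2 => tpure (g1 * h1) (g2 * h2)) (comul h))
      (comul g);
  counit1 : counit 1 = 1;
  counitM : forall g h : H, counit (g * h) = counit g * counit h;
  antipodel : forall h : H,
    tlift (fun h1 h2 => antipode h1 * h2) (comul h) = counit h *: 1;
  antipoder : forall h : H,
    tlift (fun h1 h2 => h1 * antipode h2) (comul h) = counit h *: 1
}.

#[short(type="finHopfType")]
HB.structure Definition FinHopf (k : fieldType) :=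
  { H of Falgebra k H & Falgebra_isHopf k H }.

(* [sweedler B h] is [B h_1 h_2] in Sweedler notation, for a bilinear [B]. *)
Definition sweedler (k : fieldType) (H : finHopfType k) (W : lmodType k)
    (B : H -> H -> W) (h : H) : W :=
  tlift B (comul h).

Record hopf_iso (k : fieldType) (H K : finHopfType k) (f : H -> K) : Prop := {
  hopf_iso_bij : bijective f;
  hopf_iso_linear : linear f;
  hopf_iso1 : f 1 = 1;
  hopf_isoM : {morph f : x y / x * y};
  hopf_iso_comul : forall h, comul (f h) = tmap f f (comul h);
  hopf_iso_counit : forall h, counit (f h) = counit h;
  hopf_iso_antipode : forall h, antipode (f h) = f (antipode h)
}.

Section TensorMap.
Variables (k : fieldType) (U V U' V' : vectType k) (f : U -> U') (g : V -> V').
Hypotheses (fL : linear f) (gL : linear g).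

Lemma bilin_comp (W : lmodType k) (B : U' -> V' -> W) :
  bilin B -> bilin (fun u v => B (f u) (g v)).
Proof.
by case=> Bl Br; split=> [v c x y|u c x y]; rewrite (fL, gL) (Bl, Br).
Qed.

Lemma tmap_is_linear : linear (tmap f g).
Proof. exact: tlift_is_linear. Qed.

Lemma tmap_tpure u v : tmap f g (tpure u v) = tpure (f u) (g v).
Proof. by rewrite /tmap tlift_tpure //; apply/bilin_comp/tpure_bilin. Qed.

Lemma tlift_tmap (W : lmodType k) (B : U' -> V' -> W) t :
  bilin B -> tlift B (tmap f g t) = tlift (fun u v => B (f u) (g v)) t.
Proof.
move=> BB; rewrite (tlift_comp _ _ (tlift_is_linear B)); apply: eq_tlift => u v.
by rewrite tlift_tpure.
Qed.

End TensorMap.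

Record hopf_ideal (k : fieldType) (H : finHopfType k) := HopfIdeal {
  hideal :> {vspace H};
  hideal_mull : forall a x, x \in hideal -> a * x \in hideal;
  hideal_mulr : forall a x, x \in hideal -> x * a \in hideal;
  hideal_comul : forall x, x \in hideal ->
    comul x \in (tens_space hideal {:H} + tens_space {:H} hideal)%VS;
  hideal_counit : forall x, x \in hideal -> counit x = 0;
  hideal_antipode : forall x, x \in hideal -> antipode x \in hideal
}.

(* The quotient space H/I is realised on the canonical complement of I, with
   [hquot_pi : H -> hquot I] the projection along I, whose kernel is I
   ([hquot_pi_eq0]), and [vsval] a section of it.  All operations are the ones
   induced from H along [hquot_pi]. *)
Definition hquot (k : fieldType) (H : finHopfType k) (I : hopf_ideal H) :
  predArgType := subvs_of (I^C)%VS.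

HB.instance Definition _ (k : fieldType) (H : finHopfType k) (I : hopf_ideal H) :=
  Vector.copy (hquot I) (subvs_of (I^C)%VS).

Section Quotient.
Variables (k : fieldType) (H : finHopfType k) (I : hopf_ideal H).
Local Notation Q := (hquot I).

Definition hquot_pi (x : H) : Q := vsproj (I^C)%VS (daddv_pi (I^C)%VS I x).
Definition hquot_repr (q : Q) : H := vsval q.

Let capCI : (I^C :&: I = 0)%VS. Proof. by rewrite capvC capv_compl. Qed.
Let addCI : (I^C + I = fullv)%VS. Proof. by rewrite addvC addv_complf. Qed.

Lemma hquot_pi_is_linear : linear hquot_pi.
Proof. by move=> c x y; rewrite /hquot_pi !linearP. Qed.

HB.instance Definition _ :=
  GRing.isLinear.Build k H Q *:%R hquot_pi hquot_pi_is_linear.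

Lemma hquot_repr_is_linear : linear hquot_repr.
Proof. by []. Qed.

HB.instance Definition _ :=
  GRing.isLinear.Build k Q H *:%R hquot_repr hquot_repr_is_linear.

Lemma hquot_reprK : cancel hquot_repr hquot_pi.
Proof.
by move=> q; rewrite /hquot_pi daddv_pi_id ?subvsP // /hquot_repr vsvalK.
Qed.

Lemma hquot_repr_pi x : hquot_repr (hquot_pi x) - x \in I.
Proof.
rewrite /hquot_repr /hquot_pi vsprojK ?memv_pi //.
rewrite -[x in X in _ - X](daddv_pi_add capCI (w := x)) ?addCI ?memvf //.
by rewrite opprD addNKr memvN memv_pi.
Qed.

Lemma hquot_pi_eq0 x : (hquot_pi x == 0) = (x \in I).
Proof.
apply/eqP/idP => [x0|xI].
  by have := hquot_repr_pi x; rewrite x0 linear0 sub0r memvN.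
apply/eqP; rewrite -(inj_eq (can_inj hquot_reprK)) linear0 -memv0 -capCI memv_cap.
by rewrite subvsP -[hquot_repr _](subrK x) memvD // hquot_repr_pi.
Qed.

Lemma hquot_pi_eq x y : x - y \in I -> hquot_pi x = hquot_pi y.
Proof.
by rewrite -hquot_pi_eq0 linearB subr_eq0 => /eqP.
Qed.

Lemma hquotW (P : Q -> Prop) : (forall x, P (hquot_pi x)) -> forall q, P q.
Proof. by move=> PH q; rewrite -[q]hquot_reprK. Qed.

Definition hquot_one : Q := hquot_pi 1.
Definition hquot_mul (p q : Q) : Q := hquot_pi (hquot_repr p * hquot_repr q).

Lemma hquot_piM x y : hquot_pi (x * y) = hquot_mul (hquot_pi x) (hquot_pi y).
Proof.
apply/esym/hquot_pi_eq; set x' := hquot_repr _; set y' := hquot_repr _.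
have -> : x' * y' - x * y = x' * (y' - y) + (x' - x) * y.
  by rewrite mulrBr mulrBl addrA subrK.
by apply: memvD; [apply: hideal_mull|apply: hideal_mulr]; apply: hquot_repr_pi.
Qed.

Fact hquot_mulA : associative hquot_mul.
Proof.
move=> p q r; elim/hquotW: p => x; elim/hquotW: q => y; elim/hquotW: r => z.
by rewrite -!hquot_piM mulrA.
Qed.

Fact hquot_mul1l : left_id hquot_one hquot_mul.
Proof. by move=> p; elim/hquotW: p => x; rewrite -hquot_piM mul1r. Qed.

Fact hquot_mul1r : right_id hquot_one hquot_mul.
Proof. by move=> p; elim/hquotW: p => x; rewrite -hquot_piM mulr1. Qed.

Fact hquot_mulDl : left_distributive hquot_mul +%R.
Proof. by move=> x y z; rewrite /hquot_mul linearD mulrDl linearD. Qed.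

Fact hquot_mulDr : right_distributive hquot_mul +%R.
Proof. by move=> x y z; rewrite /hquot_mul linearD mulrDr linearD. Qed.

Fact hquot_one_neq0 : hquot_one != 0.
Proof.
rewrite hquot_pi_eq0; apply/negP=> /hideal_counit/eqP.
by rewrite counit1 oner_eq0.
Qed.

HB.instance Definition _ := GRing.Zmodule_isNzRing.Build Q
  hquot_mulA hquot_mul1l hquot_mul1r hquot_mulDl hquot_mulDr hquot_one_neq0.

Fact hquot_scaleAl (c : k) (p q : Q) : c *: (p * q) = (c *: p) * q.
Proof.
elim/hquotW: p => x; elim/hquotW: q => y.
by rewrite -[_ * _]hquot_piM -!linearZ -[RHS]hquot_piM scalerAl.
Qed.

HB.instance Definition _ := GRing.Lmodule_isLalgebra.Build k Q hquot_scaleAl.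

Fact hquot_scaleAr (c : k) (p q : Q) : c *: (p * q) = p * (c *: q).
Proof.
elim/hquotW: p => x; elim/hquotW: q => y.
by rewrite -[_ * _]hquot_piM -!linearZ -[RHS]hquot_piM scalerAr.
Qed.

HB.instance Definition _ := GRing.Lalgebra_isAlgebra.Build k Q hquot_scaleAr.

HB.instance Definition _ := Algebra_isFalgebra.Build k Q.

Lemma hquot_pi_mul x y : hquot_pi (x * y) = hquot_pi x * hquot_pi y.
Proof. exact: hquot_piM. Qed.

Local Notation pi2 := (tmap hquot_pi hquot_pi).
Let piL : linear hquot_pi := hquot_pi_is_linear.

Definition hquot_comul (q : Q) : tens Q Q := pi2 (comul (hquot_repr q)).
Definition hquot_counit (q : Q) : k := counit (hquot_repr q).
Definition hquot_antipode (q : Q) : Q := hquot_pi (antipode (hquot_repr q)).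

Fact hquot_comul_is_linear : linear hquot_comul.
Proof. by move=> c p q; rewrite /hquot_comul !linearP tmap_is_linear. Qed.

Fact hquot_counit_is_scalar : scalar hquot_counit.
Proof. by move=> c p q; rewrite /hquot_counit !linearP. Qed.

Fact hquot_antipode_is_linear : linear hquot_antipode.
Proof. by move=> c p q; rewrite /hquot_antipode !linearP. Qed.

HB.instance Definition _ :=
  GRing.isLinear.Build k Q (tens Q Q) *:%R hquot_comul hquot_comul_is_linear.
HB.instance Definition _ :=
  GRing.isLinear.Build k Q k *%R hquot_counit hquot_counit_is_scalar.
HB.instance Definition _ :=
  GRing.isLinear.Build k Q Q *:%R hquot_antipode hquot_antipode_is_linear.

Lemma hquot_comul_pi x : hquot_comul (hquot_pi x) = pi2 (comul x).
Proof.
apply/eqP; rewrite -subr_eq0 -(linB (tmap_is_linear _ _)) -linearB /=.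
have /hideal_comul/memv_addP[s sI [t tI ->]] := hquot_repr_pi x.
have piT := @tmap_is_linear _ _ _ _ _ hquot_pi hquot_pi.
have E := tpure_bilin Q Q.
rewrite (linD piT) (tens_space0 piT _ sI) ?(tens_space0 piT _ tI) ?addr0 //.
  move=> a b _; rewrite -hquot_pi_eq0 => /eqP b0.
  by rewrite tmap_tpure // b0 (lin0 (E.2 _)).
move=> a b; rewrite -hquot_pi_eq0 => /eqP a0 _.
by rewrite tmap_tpure // a0 (lin0 (E.1 _)).
Qed.

Lemma hquot_counit_pi x : hquot_counit (hquot_pi x) = counit x.
Proof.
apply/eqP; rewrite -subr_eq0 /hquot_counit -linearB.
by rewrite (hideal_counit (hquot_repr_pi x)).
Qed.

Lemma hquot_antipode_pi x : hquot_antipode (hquot_pi x) = hquot_pi (antipode x).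
Proof.
by apply: hquot_pi_eq; rewrite -linearB; apply/hideal_antipode/hquot_repr_pi.
Qed.

Lemma hquot_lift_pi (W : lmodType k) (B : Q -> Q -> W) x : bilin B ->
  tlift B (hquot_comul (hquot_pi x))
  = tlift (fun a b => B (hquot_pi a) (hquot_pi b)) (comul x).
Proof. by move=> BB; rewrite hquot_comul_pi tlift_tmap. Qed.

Let E : bilin (@tpure k Q Q) := tpure_bilin Q Q.
Let E3 : bilin (@tpure k Q (tens Q Q)) := tpure_bilin Q (tens Q Q).
Let pi3 (t : tens H (tens H H)) : tens Q (tens Q Q) := tmap hquot_pi pi2 t.
Let pi2L : linear pi2 := tmap_is_linear hquot_pi hquot_pi.
Let pi3L : linear pi3 := tmap_is_linear hquot_pi pi2.

Fact hquot_comulA (q : Q) :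
  tlift (fun p1 p2 => tlift (fun x y => tpure x (tpure y p2)) (hquot_comul p1))
    (hquot_comul q)
  = tlift (fun p1 p2 => tpure p1 (hquot_comul p2)) (hquot_comul q).
Proof.
elim/hquotW: q => x; rewrite !hquot_lift_pi.
- transitivity (pi3 (tlift (fun h1 h2 => tpure h1 (comul h2)) (comul x))).
    rewrite -comulA (tlift_comp _ _ pi3L); apply: eq_tlift => a b.
    rewrite (tlift_comp _ _ pi3L) hquot_lift_pi.
      by apply: eq_tlift => c d; rewrite /pi3 !tmap_tpure.
    by split=> [v c p r|u c p r]; rewrite ?E ?E3.
  rewrite (tlift_comp _ _ pi3L); apply: eq_tlift => a b.
  by rewrite hquot_comul_pi /pi3 tmap_tpure.
- by split=> [v c p r|u c p r]; rewrite (hquot_comul_is_linear, E3) ?E3.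
- split=> [v c p r|u c p r].
    by rewrite hquot_comul_is_linear tlift_is_linear.
  apply: (@tlift_param k Q Q Q _ (fun s a b => tpure a (tpure b s))) => a b d s t.
  by rewrite E E3.
Qed.

Fact hquot_counitl (q : Q) :
  tlift (fun p1 p2 => hquot_counit p1 *: p2) (hquot_comul q) = q.
Proof.
elim/hquotW: q => x; rewrite hquot_lift_pi.
  rewrite -{2}[x]counitl (tlift_comp _ _ piL); apply: eq_tlift => a b.
  by rewrite hquot_counit_pi linearZ.
split=> [v c p r|u c p r]; last by rewrite /= scalerDr !scalerA [c * _]mulrC.
by rewrite linearP /= scalerDl scalerA.
Qed.

Fact hquot_counitr (q : Q) :
  tlift (fun p1 p2 => hquot_counit p2 *: p1) (hquot_comul q) = q.
Proof.
elim/hquotW: q => x; rewrite hquot_lift_pi.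
  rewrite -{2}[x]counitr (tlift_comp _ _ piL); apply: eq_tlift => a b.
  by rewrite hquot_counit_pi linearZ.
split=> [v c p r|u c p r]; first by rewrite /= scalerDr !scalerA [c * _]mulrC.
by rewrite linearP /= scalerDl scalerA.
Qed.

Fact hquot_comul1 : hquot_comul 1 = tpure 1 1.
Proof. by rewrite -[1]/(hquot_pi 1) hquot_comul_pi comul1 tmap_tpure. Qed.

Fact hquot_comulM (p q : Q) :
  hquot_comul (p * q) =
  tlift (fun p1 p2 => tlift (fun q1 q2 => tpure (p1 * q1) (p2 * q2))
    (hquot_comul q)) (hquot_comul p).
Proof.
have mulBl (a b : Q) : bilin (fun x y => tpure (x * a) (y * b)).
  by split=> [v c x y|u c x y]; rewrite mulrDl -scalerAl E.
have mulBr (a b : Q) : bilin (fun x y => tpure (a * x) (b * y)).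
  by split=> [v c x y|u c x y]; rewrite mulrDr -scalerAr E.
elim/hquotW: p => x; elim/hquotW: q => y; rewrite hquot_lift_pi.
  rewrite -hquot_pi_mul hquot_comul_pi comulM (tlift_comp _ _ pi2L).
  apply: eq_tlift => a b; rewrite (tlift_comp _ _ pi2L) hquot_lift_pi //.
  by apply: eq_tlift => c d; rewrite tmap_tpure // !hquot_pi_mul.
split=> [v c u w|u c v w].
  by apply: (@tlift_param k Q Q Q _ (fun s a b => tpure (s * a) (v * b)))
    => a b; apply: (mulBl a _).1.
by apply: (@tlift_param k Q Q Q _ (fun s a b => tpure (u * a) (s * b)))
  => a b; apply: (mulBl _ b).2.
Qed.

Fact hquot_counit1 : hquot_counit 1 = 1.
Proof. by rewrite -[1 in LHS]/(hquot_pi 1) hquot_counit_pi counit1. Qed.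

Fact hquot_counitM (p q : Q) :
  hquot_counit (p * q) = hquot_counit p * hquot_counit q.
Proof.
elim/hquotW: p => x; elim/hquotW: q => y.
by rewrite -hquot_pi_mul !hquot_counit_pi counitM.
Qed.

Fact hquot_antipodel (q : Q) :
  tlift (fun p1 p2 => hquot_antipode p1 * p2) (hquot_comul q)
  = hquot_counit q *: 1.
Proof.
elim/hquotW: q => x; rewrite hquot_lift_pi.
  rewrite hquot_counit_pi -[1]/(hquot_pi 1) -(linZ piL) -antipodel.
  rewrite (tlift_comp _ _ piL); apply: eq_tlift => a b.
  by rewrite hquot_antipode_pi -hquot_pi_mul.
split=> [v c p r|u c p r]; last by rewrite mulrDr -scalerAr.
by rewrite linearP /= mulrDl -scalerAl.
Qed.

Fact hquot_antipoder (q : Q) :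
  tlift (fun p1 p2 => p1 * hquot_antipode p2) (hquot_comul q)
  = hquot_counit q *: 1.
Proof.
elim/hquotW: q => x; rewrite hquot_lift_pi.
  rewrite hquot_counit_pi -[1]/(hquot_pi 1) -(linZ piL) -antipoder.
  rewrite (tlift_comp _ _ piL); apply: eq_tlift => a b.
  by rewrite hquot_antipode_pi -hquot_pi_mul.
split=> [v c p r|u c p r]; first by rewrite mulrDl -scalerAl.
by rewrite linearP /= mulrDr -scalerAr.
Qed.

HB.instance Definition _ := Falgebra_isHopf.Build k Q
  hquot_comulA hquot_counitl hquot_counitr hquot_comul1 hquot_comulM
  hquot_counit1 hquot_counitM hquot_antipodel hquot_antipoder.

End Quotient.

(* The group algebra kG, with basis the elements [gdelta g], on which
   comultiplication is diagonal.  The alias hides the pointwise product of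
   finite functions. *)
Definition group_alg (k : fieldType) (gT : finGroupType) : predArgType :=
  {ffun gT -> k^o}.

HB.instance Definition _ (k : fieldType) (gT : finGroupType) :=
  Vector.copy (group_alg k gT) {ffun gT -> k^o}.

Section GroupAlgebra.
Variables (k : fieldType) (gT : finGroupType).
Local Notation G := (group_alg k gT).

Definition gcoef (a : G) (g : gT) : k := (a : {ffun gT -> k^o}) g.
Definition gdelta (g : gT) : G := [ffun h => (h == g)%:R : k^o].

(* Linear extension of a function defined on group elements. *)
Definition glift (W : lmodType k) (f : gT -> W) (a : G) : W :=
  \sum_g gcoef a g *: f g.

Lemma glift_is_linear (W : lmodType k) (f : gT -> W) : linear (glift f).
Proof.
move=> c a b; rewrite /glift scaler_sumr -big_split; apply: eq_bigr => g _ /=.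
by rewrite /gcoef !ffunE scalerDl scalerA.
Qed.

Lemma glift_delta (W : lmodType k) (f : gT -> W) g : glift f (gdelta g) = f g.
Proof.
rewrite /glift (bigD1 g) //= big1 ?addr0 => [|h hg].
  by rewrite /gcoef ffunE eqxx scale1r.
by rewrite /gcoef ffunE (negPf hg) scale0r.
Qed.

Lemma glift_param (X W : lmodType k) (F : X -> gT -> W) a :
  (forall g, linear (fun x => F x g)) -> linear (fun x => glift (F x) a).
Proof.
move=> FL c x y; rewrite /glift scaler_sumr -big_split; apply: eq_bigr => g _ /=.
by rewrite FL scalerDr !scalerA [c * _]mulrC.
Qed.

Lemma glift_id a : glift gdelta a = a.
Proof.
apply/ffunP=> g; rewrite sum_ffunE (bigD1 g) //= big1 ?addr0 => [|h hg].
  by rewrite !ffunE eqxx [_ *: _]mulr1.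
by rewrite !ffunE eq_sym (negPf hg) [_ *: _]mulr0.
Qed.

Lemma galg_ext (W : lmodType k) (f g : G -> W) : linear f -> linear g ->
  (forall x, f (gdelta x) = g (gdelta x)) -> f =1 g.
Proof.
move=> fL gL fg a; rewrite -[a]glift_id /glift (lin_sum fL) (lin_sum gL).
by apply: eq_bigr => x _; rewrite (linZ fL) (linZ gL) fg.
Qed.

Definition galg_mul (a b : G) : G :=
  glift (fun g => glift (fun h => gdelta (g * h)%g) b) a.

Lemma galg_mul_bilin : bilin galg_mul.
Proof.
split=> [b|a]; first exact: glift_is_linear.
by apply: glift_param => g; apply: glift_is_linear.
Qed.

Let ml := galg_mul_bilin.1.
Let mr := galg_mul_bilin.2.

Lemma galg_mul_delta g h : galg_mul (gdelta g) (gdelta h) = gdelta (g * h)%g.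
Proof. by rewrite /galg_mul !glift_delta. Qed.

Fact galg_mulA : associative galg_mul.
Proof.
move=> a b c; move: a; apply: galg_ext => [e x y|e x y|g].
- by rewrite ml.
- by rewrite !ml.
move: b; apply: galg_ext => [e x y|e x y|h].
- by rewrite ml mr.
- by rewrite mr ml.
move: c; apply: galg_ext => [e x y|e x y|l].
- by rewrite !mr.
- by rewrite mr.
by rewrite !galg_mul_delta mulgA.
Qed.

Fact galg_mul1l : left_id (gdelta 1%g) galg_mul.
Proof.
apply: galg_ext => [e x y|e x y|g]; rewrite ?mr //.
by rewrite galg_mul_delta mul1g.
Qed.

Fact galg_mul1r : right_id (gdelta 1%g) galg_mul.
Proof.
apply: galg_ext => [e x y|e x y|g]; rewrite ?ml //.
by rewrite galg_mul_delta mulg1.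
Qed.

Fact galg_mulDl : left_distributive galg_mul +%R.
Proof. by move=> x y z; rewrite (linD (ml z)). Qed.

Fact galg_mulDr : right_distributive galg_mul +%R.
Proof. by move=> x y z; rewrite (linD (mr x)). Qed.

Fact galg_one_neq0 : gdelta 1%g != 0.
Proof.
apply/eqP=> /ffunP/(_ 1%g)/eqP; rewrite !ffunE eqxx.
by rewrite oner_eq0.
Qed.

HB.instance Definition _ := GRing.Zmodule_isNzRing.Build G
  galg_mulA galg_mul1l galg_mul1r galg_mulDl galg_mulDr galg_one_neq0.

Fact galg_scaleAl (c : k) (a b : G) : c *: (a * b) = (c *: a) * b.
Proof. by rewrite -(linZ (ml b)). Qed.

HB.instance Definition _ := GRing.Lmodule_isLalgebra.Build k G galg_scaleAl.

Fact galg_scaleAr (c : k) (a b : G) : c *: (a * b) = a * (c *: b).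
Proof. by rewrite -(linZ (mr a)). Qed.

HB.instance Definition _ := GRing.Lalgebra_isAlgebra.Build k G galg_scaleAr.

HB.instance Definition _ := Algebra_isFalgebra.Build k G.

Lemma gdeltaM g h : gdelta g * gdelta h = gdelta (g * h)%g.
Proof. exact: galg_mul_delta. Qed.

Lemma gdelta1 : gdelta 1%g = 1.
Proof. by []. Qed.

Definition galg_comul : G -> tens G G := glift (fun g => tpure (gdelta g) (gdelta g)).
Definition galg_counit : G -> k := glift (fun=> 1 : k^o).
Definition galg_antipode : G -> G := glift (fun g => gdelta g^-1%g).

Let comulL : linear galg_comul := glift_is_linear _.
Let counitL : scalar galg_counit.
Proof. by move=> c a b; apply: (glift_is_linear (fun=> 1 : k^o)). Qed.
Let antipodeL : linear galg_antipode := glift_is_linear _.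

HB.instance Definition _ :=
  GRing.isLinear.Build k G (tens G G) *:%R galg_comul comulL.
HB.instance Definition _ := GRing.isLinear.Build k G k *%R galg_counit counitL.
HB.instance Definition _ := GRing.isLinear.Build k G G *:%R galg_antipode antipodeL.

Lemma galg_comul_delta g : galg_comul (gdelta g) = tpure (gdelta g) (gdelta g).
Proof. exact: glift_delta. Qed.

Lemma galg_counit_delta g : galg_counit (gdelta g) = 1.
Proof. exact: (glift_delta (fun=> 1 : k^o)). Qed.

Lemma galg_antipode_delta g : galg_antipode (gdelta g) = gdelta g^-1%g.
Proof. exact: glift_delta. Qed.

Let E : bilin (@tpure k G G) := tpure_bilin G G.
Let E3 : bilin (@tpure k G (tens G G)) := tpure_bilin G (tens G G).

Let tlift_comul (W : lmodType k) (B : G -> G -> W) :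
  linear (fun a => tlift B (galg_comul a)).
Proof. by move=> c a b; rewrite comulL tlift_is_linear. Qed.

Let tlift_comul_delta (W : lmodType k) (B : G -> G -> W) g : bilin B ->
  tlift B (galg_comul (gdelta g)) = B (gdelta g) (gdelta g).
Proof. by move=> BB; rewrite galg_comul_delta tlift_tpure. Qed.

Fact galg_comulA (a : G) :
  tlift (fun a1 a2 => tlift (fun x y => tpure x (tpure y a2)) (galg_comul a1))
    (galg_comul a)
  = tlift (fun a1 a2 => tpure a1 (galg_comul a2)) (galg_comul a).
Proof.
move: a; apply: galg_ext => [||g]; try exact: tlift_comul.
have BB (v : G) : bilin (fun x y : G => tpure x (tpure y v)).
  split=> [w c p r|w c p r]; first by rewrite E3.1.
  by rewrite E.1 E3.2.
rewrite tlift_comul_delta; last first.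
  split=> [v|u]; first exact: tlift_comul.
  apply: (@tlift_param k G G G _ (fun s a b => tpure a (tpure b s))) => x y c s t.
  by rewrite E.2 E3.2.
rewrite tlift_comul_delta // tlift_comul_delta ?galg_comul_delta //.
split=> [v c p r|u c p r]; first by rewrite E3.1.
by rewrite comulL E3.2.
Qed.

Fact galg_counitl (a : G) :
  tlift (fun a1 a2 => galg_counit a1 *: a2) (galg_comul a) = a.
Proof.
move: a; apply: galg_ext => [|//|g]; first exact: tlift_comul.
rewrite tlift_comul_delta ?galg_counit_delta ?scale1r //.
split=> [v c p r|u c p r]; last by rewrite /= scalerDr !scalerA [c * _]mulrC.
by rewrite counitL scalerDl -scalerA.
Qed.

Fact galg_counitr (a : G) :
  tlift (fun a1 a2 => galg_counit a2 *: a1) (galg_comul a) = a.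
Proof.
move: a; apply: galg_ext => [|//|g]; first exact: tlift_comul.
rewrite tlift_comul_delta ?galg_counit_delta ?scale1r //.
split=> [v c p r|u c p r]; first by rewrite /= scalerDr !scalerA [c * _]mulrC.
by rewrite counitL scalerDl -scalerA.
Qed.

Fact galg_comul1 : galg_comul 1 = tpure 1 1.
Proof. exact: galg_comul_delta. Qed.

Fact galg_comulM (a b : G) :
  galg_comul (a * b) =
  tlift (fun a1 a2 => tlift (fun b1 b2 => tpure (a1 * b1) (a2 * b2))
    (galg_comul b)) (galg_comul a).
Proof.
have mulBl (x y : G) : bilin (fun s t => tpure (s * x) (t * y)).
  by split=> [v c s t|u c s t]; rewrite mulrDl -scalerAl E.
have mulBr (x y : G) : bilin (fun s t => tpure (x * s) (y * t)).
  by split=> [v c s t|u c s t]; rewrite mulrDr -scalerAr E.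
have BB : bilin (fun a1 a2 => tlift (fun b1 b2 => tpure (a1 * b1) (a2 * b2))
    (galg_comul b)).
  split=> [v|u].
    by apply: (@tlift_param k G G G _ (fun s a b => tpure (s * a) (v * b)))
      => x y; apply: (mulBl x _).1.
  by apply: (@tlift_param k G G G _ (fun s a b => tpure (u * a) (s * b)))
    => x y; apply: (mulBl _ y).2.
move: a; apply: galg_ext => [c s t||g]; last 1 first.
- rewrite tlift_comul_delta //.
  move: b {BB}; apply: galg_ext => [c s t||h]; last 1 first.
  + by rewrite tlift_comul_delta // gdeltaM galg_comul_delta.
  + by rewrite mulrDr -scalerAr comulL.
  + exact: tlift_comul.
- by rewrite mulrDl -scalerAl comulL.
- exact: tlift_comul.
Qed.

Fact galg_counit1 : galg_counit 1 = 1.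
Proof. exact: galg_counit_delta. Qed.

Fact galg_counitM (a b : G) : galg_counit (a * b) = galg_counit a * galg_counit b.
Proof.
move: a; apply: (@galg_ext k^o) => [c s t|c s t|g].
- by rewrite mulrDl -scalerAl counitL.
- by rewrite counitL mulrDl -mulrA.
move: b; apply: (@galg_ext k^o) => [c s t|c s t|h].
- by rewrite mulrDr -scalerAr counitL.
- by rewrite counitL mulrDr mulrCA.
by rewrite gdeltaM !galg_counit_delta mulr1.
Qed.

Fact galg_antipodel (a : G) :
  tlift (fun a1 a2 => galg_antipode a1 * a2) (galg_comul a)
  = galg_counit a *: 1.
Proof.
move: a; apply: galg_ext => [|c s t|g]; first exact: tlift_comul.
  by rewrite counitL scalerDl -scalerA.
rewrite tlift_comul_delta.
  by rewrite galg_antipode_delta galg_counit_delta gdeltaM mulVg scale1r.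
split=> [v c p r|u c p r]; last by rewrite mulrDr -scalerAr.
by rewrite antipodeL mulrDl -scalerAl.
Qed.

Fact galg_antipoder (a : G) :
  tlift (fun a1 a2 => a1 * galg_antipode a2) (galg_comul a)
  = galg_counit a *: 1.
Proof.
move: a; apply: galg_ext => [|c s t|g]; first exact: tlift_comul.
  by rewrite counitL scalerDl -scalerA.
rewrite tlift_comul_delta.
  by rewrite galg_antipode_delta galg_counit_delta gdeltaM mulgV scale1r.
split=> [v c p r|u c p r]; first by rewrite mulrDl -scalerAl.
by rewrite antipodeL mulrDr -scalerAr.
Qed.

HB.instance Definition _ := Falgebra_isHopf.Build k G
  galg_comulA galg_counitl galg_counitr galg_comul1 galg_comulM
  galg_counit1 galg_counitM galg_antipodel galg_antipoder.

End GroupAlgebra.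

Record is_poisson (k : fieldType) (A : comAlgType k)
    (br : {bilinear A -> A -> A}) : Prop := {
  poisson_alt : forall a, br a a = 0;
  poisson_jacobi : forall a b c, br a (br b c) + br b (br c a) + br c (br a b) = 0;
  poisson_leibniz : forall a b c, br a (b * c) = br a b * c + b * br a c
}.

Record is_module_poisson (k : fieldType) (H : finHopfType k) (A : comAlgType k)
    (br : {bilinear A -> A -> A}) (act : {bilinear H -> A -> A}) : Prop := {
  hact_1 : forall a, act 1 a = a;
  hact_M : forall g h a, act (g * h) a = act g (act h a);
  hact_unit : forall h, act h 1 = counit h *: 1;
  hact_mul : forall h a b,
    act h (a * b) = sweedler (fun h1 h2 => act h1 a * act h2 b) h;
  hact_bracket : forall h a b,
    act h (br a b) = sweedler (fun h1 h2 => br (act h1 a) (act h2 b)) h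
}.

(* Only finite groups are needed: H/I is finite-dimensional, so a group whose
   group algebra is isomorphic to H/I is finite. *)
Definition factors_through_group_algebra (k : fieldType) (H : finHopfType k)
    (A : comAlgType k) (act : {bilinear H -> A -> A}) : Prop :=
  exists I : hopf_ideal H,
    (forall h a, h \in (I : {vspace H}) -> act h a = 0) /\
    exists (gT : finGroupType) (f : hquot I -> group_alg k gT), hopf_iso f.

Section Filtration.
Variables (k : fieldType) (n : nat).
Local Notation P := {mpoly k[n]}.

(* Total degree at most d; [msize] is one more than the total degree. *)
Definition mfilt (d : nat) : {pred P} := [pred p | msize p <= d.+1]%N.

Definition filtered_quadratic (br : {bilinear P -> P -> P}) : Prop :=
  forall i j : 'I_n, br 'X_i 'X_j \in mfilt 2.

Definition preserves_filtration (H : finHopfType k)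
    (act : {bilinear H -> P -> P}) : Prop :=
  forall d h p, p \in mfilt d -> act h p \in mfilt d.

End Filtration.

(* Main.v *)
(* Write y = (1, X_0, X_1) and h . y_a = sum_j M_aj(h) y_j, which is possible
   since the action preserves the filtration.  The entries M_aj lie in the dual
   algebra of H.  Since P is commutative, the coefficients of h . (y_a y_b) give
   relations between their commutators; since {X_0, X_1} is nonzero, the
   compatibility with {y_a, y_b} gives enough further relations to make the
   linear part of M commutative, and the compatibility with {y_a, y_b y_c} makes
   the translation part M_a0 commute with the linear part.  So the M_aj generate
   a commutative subalgebra A of the dual, stable under translations, and its
   annihilator I is a Hopf ideal which kills P and has a commutative dual
   quotient.  In characteristic 0 the trace form of the dual of a cocommutative
   Hopf algebra Q is nondegenerate, so that this dual is reduced and acts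
   diagonalizably on Q; the common eigenvectors are multiples of grouplike
   elements, and Q is the algebra of the group of grouplike elements. *)

Require Import Defs.
From HB Require Import structures.
From mathcomp Require Import all_boot all_order all_fingroup all_algebra all_field.
From mathcomp Require Import mpoly.

Set Implicit Arguments.
Unset Strict Implicit.
Unset Printing Implicit Defensive.

Import GRing.Theory.
Local Open Scope ring_scope.

Local Notation bilin B := (bilinear_for *:%R *:%R B).

(** * The dual algebra *)

Definition trilin (k : fieldType) (U V X W : lmodType k) (T : U -> V -> X -> W) :=
  [/\ forall y z, linear (fun x => T x y z), forall x z, linear (fun y => T x y z)
    & forall x y, linear (T x y)].

Section Sweedler.
Variables (k : fieldType) (H : finHopfType k).

Lemma tlift_is_bilin (U V : vectType k) (X W : lmodType k) (F : X -> U -> V -> W) :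
  (forall u v, linear (fun x => F x u v)) -> bilin (fun x t => tlift (F x) t).
Proof. by move=> FL; split=> [t|x]; [apply: tlift_param | apply: tlift_is_linear]. Qed.

Lemma tlift_comulL (W : lmodType k) (B : H -> H -> W) :
  linear (fun h => tlift B (comul h)).
Proof. by move=> c x y; rewrite linearP tlift_is_linear. Qed.

(** The axiom [comulA] is transported along the linear map on [tens H (tens H H)] that [T]
    induces. *)
Lemma coassoc (W : lmodType k) (T : H -> H -> H -> W) h : trilin T ->
  tlift (fun a b => tlift (fun x y => T x y b) (comul a)) (comul h) =
  tlift (fun a b => tlift (fun x y => T a x y) (comul b)) (comul h).
Proof.
case=> T1 T2 T3; pose G := tlift (fun x => tlift (T x)) : tens H (tens H H) -> W.
have GL : linear G by apply: tlift_is_linear.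
have GT x s : G (tpure x s) = tlift (T x) s.
  rewrite /G (@tlift_tpure k H (tens H H) W (fun x s => tlift (T x) s)) //.
  by apply: tlift_is_bilin => y z; apply: T1.
have /(congr1 G) := comulA h; rewrite !(tlift_comp _ _ GL) => Gh.
transitivity (tlift (fun u v => G (tlift (fun x y => tpure x (tpure y v)) (comul u)))
  (comul h)).
  apply: eq_tlift => a b; rewrite (tlift_comp _ _ GL); apply: eq_tlift => x y.
  by rewrite GT tlift_tpure.
by rewrite Gh; apply: eq_tlift => a b; rewrite GT.
Qed.

End Sweedler.

(** An alias of the space of linear forms, made to carry the convolution product as its ring
    structure. *)
Definition dual (k : fieldType) (H : finHopfType k) : predArgType := 'Hom(H, k^o).

HB.instance Definition _ (k : fieldType) (H : finHopfType k) :=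
  Vector.copy (dual H) 'Hom(H, k^o).

Definition ev (k : fieldType) (H : finHopfType k) (u : dual H) : H -> k :=
  fun_of_lfun u.

Section Dual.
Variables (k : fieldType) (H : finHopfType k).
Implicit Types (u v w : dual H) (h : H).

Lemma evL u : scalar (ev u).
Proof. by move=> c x y; rewrite /ev linearP. Qed.

HB.instance Definition _ u :=
  GRing.isLinear.Build k H k *%R (ev u) (evL u).

Lemma dualP u v : ev u =1 ev v <-> u = v.
Proof. exact: (@lfunP k H k^o u v). Qed.

(** [linfun] accepts any function but agrees with it only if it is linear, so every use is paired
    with [dual_ofE]. *)
Definition dual_of (f : H -> k) : dual H := linfun (f : H -> k^o).

Lemma dual_ofE (f : H -> k) : scalar f -> forall h, ev (dual_of f) h = f h.
Proof.
move=> fL h; pose g : {linear H -> k^o} :=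
  HB.pack (f : H -> k^o) (GRing.isLinear.Build k H k^o *:%R f fL).
by rewrite /ev (lfunE g).
Qed.

Lemma dualD u v h : ev (u + v) h = ev u h + ev v h.
Proof. exact: (@add_lfunE _ H k^o u v h). Qed.
Lemma dualZ c u h : ev (c *: u) h = c * ev u h.
Proof. exact: (@scale_lfunE _ H k^o c u h). Qed.
Lemma dual0 h : ev (0 : dual H) h = 0.
Proof. by rewrite -(scale0r (0 : dual H)) dualZ mul0r. Qed.
Lemma dual_sum (I : Type) (r : seq I) (P : pred I) (F : I -> dual H) h :
  ev (\sum_(i <- r | P i) F i) h = \sum_(i <- r | P i) ev (F i) h.
Proof. by elim/big_rec2: _ => [|i x y _ <-]; rewrite ?dual0 ?dualD. Qed.

Lemma ev_bilin u v : bilin (fun a b : H => ev u a * ev v b : k^o).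
Proof.
split=> [b c x y|a c x y]; rewrite linearP; first by rewrite mulrDl -mulrA.
by rewrite mulrDr mulrCA.
Qed.

Definition dual_one : dual H := dual_of counit.
(** The convolution product, which is the transpose of [comul]. *)
Definition dual_mul u v : dual H :=
  dual_of (fun h => tlift (fun a b => (ev u a * ev v b : k^o)) (comul h)).

Lemma dual_oneE h : ev dual_one h = counit h.
Proof. by apply: dual_ofE => c x y; rewrite linearP. Qed.

Lemma dual_mulE u v h :
  ev (dual_mul u v) h = tlift (fun a b => (ev u a * ev v b : k^o)) (comul h).
Proof. by apply: dual_ofE; apply: (@tlift_comulL _ _ k^o). Qed.

Fact dual_mulA : associative dual_mul.
Proof.
move=> u v w; apply/dualP=> h; rewrite !dual_mulE.
transitivity (tlift (fun a b =>
    tlift (fun x y => (ev u a * ev v x * ev w y : k^o)) (comul b)) (comul h)).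
  apply: (@eq_tlift _ _ _ k^o) => a b; rewrite dual_mulE.
  rewrite (tlift_comp _ _ (f := fun z : k^o => ev u a * z : k^o)) => [|c x y].
    by apply: (@eq_tlift _ _ _ k^o) => x y; rewrite mulrA.
  by rewrite mulrDr mulrCA.
rewrite -(@coassoc _ _ k^o (fun a x y => ev u a * ev v x * ev w y)).
  apply: (@eq_tlift _ _ _ k^o) => a b; rewrite dual_mulE.
  rewrite (tlift_comp _ _ (f := fun z : k^o => z * ev w b : k^o)) // => c x y.
  by rewrite mulrDl -mulrA.
by split=> [y z|x z|x y] c s t /=;
  rewrite linearP ?mulrDr ?mulrDl ?[_ * (c * _)]mulrCA -?mulrA.
Qed.

Fact dual_mul1l : left_id dual_one dual_mul.
Proof.
move=> u; apply/dualP=> h; rewrite dual_mulE -[in RHS](counitl h).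
rewrite (tlift_comp _ _ (f := ev u : H -> k^o)); last exact: evL.
by apply: (@eq_tlift _ _ _ k^o) => a b; rewrite dual_oneE linearZ.
Qed.

Fact dual_mul1r : right_id dual_one dual_mul.
Proof.
move=> u; apply/dualP=> h; rewrite dual_mulE -[in RHS](counitr h).
rewrite (tlift_comp _ _ (f := ev u : H -> k^o)); last exact: evL.
by apply: (@eq_tlift _ _ _ k^o) => a b; rewrite dual_oneE linearZ /= mulrC.
Qed.

Lemma dual_mul_bilin : bilin dual_mul.
Proof.
split=> [v c x y|u c x y]; apply/dualP=> h; rewrite dualD dualZ !dual_mulE.
  have FL a b : linear (fun z : dual H => ev z a * ev v b : k^o).
    by move=> d z t; rewrite dualD dualZ mulrDl -mulrA.
  exact: (@tlift_param _ _ _ (dual H) k^o (fun z a b => ev z a * ev v b) (comul h) FL).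
have FL a b : linear (fun z : dual H => ev u a * ev z b : k^o).
  by move=> d z t; rewrite dualD dualZ mulrDr mulrCA.
exact: (@tlift_param _ _ _ (dual H) k^o (fun z a b => ev u a * ev z b) (comul h) FL).
Qed.

Fact dual_mulDl : left_distributive dual_mul +%R.
Proof. by move=> x y z; rewrite (linD (dual_mul_bilin.1 z)). Qed.

Fact dual_mulDr : right_distributive dual_mul +%R.
Proof. by move=> x y z; rewrite (linD (dual_mul_bilin.2 x)). Qed.

Fact dual_one_neq0 : dual_one != 0.
Proof.
apply/eqP=> /dualP/(_ 1)/eqP; rewrite dual_oneE counit1 dual0.
by rewrite oner_eq0.
Qed.

HB.instance Definition _ := GRing.Zmodule_isNzRing.Build (dual H)
  dual_mulA dual_mul1l dual_mul1r dual_mulDl dual_mulDr dual_one_neq0.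

Fact dual_scaleAl (c : k) u v : c *: (u * v) = (c *: u) * v.
Proof. by rewrite -(linZ (dual_mul_bilin.1 v)). Qed.

HB.instance Definition _ :=
  GRing.Lmodule_isLalgebra.Build k (dual H) dual_scaleAl.

Fact dual_scaleAr (c : k) u v : c *: (u * v) = u * (c *: v).
Proof. by rewrite -(linZ (dual_mul_bilin.2 u)). Qed.

HB.instance Definition _ := GRing.Lalgebra_isAlgebra.Build k (dual H) dual_scaleAr.

HB.instance Definition _ := Algebra_isFalgebra.Build k (dual H).

Lemma dual1E h : ev (1 : dual H) h = counit h.
Proof. exact: dual_oneE. Qed.

Lemma dualM u v h : ev (u * v) h = tlift (fun a b => (ev u a * ev v b : k^o)) (comul h).
Proof. exact: dual_mulE. Qed.

Definition dual_coord (i : 'I_(\dim {:H})) : dual H :=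
  dual_of (coord (vbasis {:H}) i).

Lemma dual_coordE i h : ev (dual_coord i) h = coord (vbasis {:H}) i h.
Proof. by apply: dual_ofE => c x y; rewrite linearP. Qed.

(** Pairs of dual basis vectors read off every entry of a tensor, so identities in [tens H H] can be
    tested on linear forms. *)
Lemma tens_coordE (t : tens H H) i j :
  tlift (fun a b => (ev (dual_coord i) a * ev (dual_coord j) b : k^o)) t = t i j.
Proof.
rewrite -[t in RHS]tlift_id.
rewrite (tlift_comp _ _ (f := fun s : tens H H => s i j : k^o)); last first.
  by move=> c x y; rewrite !mxE.
by apply: (@eq_tlift _ _ _ k^o) => a b; rewrite !dual_coordE mxE.
Qed.

(** The [(i, j)] entry of [comul h] is the value at [h] of [dual_coord i * dual_coord j], so a
    commutative dual means a cocommutative [H]. *)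
Lemma sweedlerC (W : lmodType k) (B : H -> H -> W) h :
  commutative (@GRing.mul (dual H)) ->
  tlift B (comul h) = tlift (fun a b => B b a) (comul h).
Proof.
move=> mulC; rewrite /tlift exchange_big; apply: eq_bigr => i _ /=.
apply: eq_bigr => j _; congr (_ *: _).
by rewrite -[LHS]tens_coordE -[RHS]tens_coordE -!dualM mulC.
Qed.

End Dual.

(** * Finite-dimensional cocommutative Hopf algebras are group algebras *)

Section Matrices.
Variable k : closedFieldType.

(** All eigenvalues vanish, so the characteristic polynomial is a power of ['X]; its subleading
    coefficient is minus the trace. *)
Lemma mxtrace_nilpotent n (A : 'M[k]_n) m : A ^+ m = 0 -> \tr A = 0.
Proof.
case: n A => [|n] A Am0; first by rewrite /mxtrace big_ord0.
have [rs Ers] := closed_field_poly_normal (char_poly A).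
rewrite (monicP (char_poly_monic A)) scale1r in Ers.
have rs0 a : a \in rs -> a = 0.
  move=> a_rs; have: eigenvalue A a.
    by rewrite eigenvalue_root_char Ers root_prod_XsubC.
  case/eigenvalueP=> v vA v0.
  have vAi i : v *m A ^+ i = a ^+ i *: v.
    elim: i => [|i IHi]; first by rewrite !expr0 scale1r mulmx1.
    by rewrite exprS -[A * _]/(A *m _) mulmxA vA -scalemxAl IHi scalerA exprS.
  move: (vAi m); rewrite Am0 mulmx0 => /esym/eqP.
  by rewrite scaler_eq0 (negPf v0) orbF expf_eq0 => /andP[_ /eqP].
have EX : char_poly A = 'X^(n.+1).
  have size_rs : size rs = n.+1.
    by apply/succn_inj; rewrite -(size_prod_XsubC rs id) -Ers size_char_poly.
  rewrite Ers (eq_big_seq (fun=> 'X)) => [|a /rs0->]; last by rewrite polyC0 subr0.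
  by rewrite big_const_seq count_predT iter_mulr_1 size_rs.
apply/eqP; rewrite -oppr_eq0 -char_poly_trace // EX coefXn /=.
by rewrite ltn_eqF // eqxx.
Qed.

(* If q is the squarefree part of the minimal polynomial of A, then q(A) is
   nilpotent. *)
Lemma diagonalizable_reduced n (S : 'M[k]_n -> Prop) A :
  S 1%:M -> (forall c B C, S B -> S C -> S (c *: B + C)) ->
  (forall B C, S B -> S C -> S (B *m C)) ->
  (forall B m, S B -> B ^+ m = 0 -> B = 0) -> S A -> diagonalizable A.
Proof.
case: n S A => [|n] S A S1 SL SM S0 SA.
  by exists 1%:M; rewrite ?unitmx1 //; apply/diagonalizable_forPp => -[].
have Sh p : S (horner_mx A p).
  elim/poly_ind: p => [|p c IHp].
    by rewrite rmorph0 -[0](subrr (- 1%:M)) opprK -scaleN1r; apply: SL.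
  rewrite rmorphD rmorphM /= horner_mx_X horner_mx_C -scalemx1 addrC.
  by apply: SL => //; apply: SM.
apply/diagonalizableP.
have [rs Ers] := closed_field_poly_normal (mxminpoly A).
rewrite (monicP (mxminpoly_monic A)) scale1r in Ers.
exists (undup rs); first exact: undup_uniq.
set q := \prod_(x <- undup rs) _.
apply/mxminpoly_min/(S0 _ (size rs)) => //.
rewrite -rmorphXn /=; apply/mxminpoly_minP; rewrite Ers.
(* Each of the [size rs] linear factors of the minimal polynomial divides [q]. Passing to sublists
   [s] keeps [q] fixed during the induction. *)
suff dvd_q s : {subset s <= rs} -> \prod_(x <- s) ('X - x%:P) %| q ^+ size s.
  exact: dvd_q.
elim: s => [|x s IHs] sub; first by rewrite big_nil dvd1p.
rewrite big_cons exprS dvdp_mul ?IHs // => [|y ys]; last by rewrite sub // inE ys orbT.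
by rewrite dvdp_XsubCl root_prod_XsubC mem_undup sub ?mem_head.
Qed.

End Matrices.

Lemma tlift_exchange (k : fieldType) (U V U' V' : vectType k) (W : lmodType k)
    (F : U -> V -> U' -> V' -> W) s t :
  tlift (fun a b => tlift (F a b) t) s =
  tlift (fun c d => tlift (fun a b => F a b c d) s) t.
Proof.
rewrite /tlift; under eq_bigr => i _ do
  (under eq_bigr => j _ do (rewrite scaler_sumr;
    under eq_bigr => l _ do rewrite scaler_sumr);
   rewrite exchange_big; under eq_bigr => l _ do rewrite exchange_big).
rewrite exchange_big; apply: eq_bigr => l _ /=; rewrite exchange_big /=.
apply: eq_bigr => m _; rewrite scaler_sumr; apply: eq_bigr => i _.
by rewrite scaler_sumr; apply: eq_bigr => j _; rewrite !scalerA mulrC.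
Qed.

(** * The actions of the dual on H and of H on its dual *)

Section Regular.
Variables (k : fieldType) (H : finHopfType k).
Implicit Types (u v w : dual H) (g h : H).

(** The transpose of left multiplication by [u] in the dual; [contractM] shows that it is a right
    action. *)
Definition contract u : 'End(H) :=
  linfun (fun h => tlift (fun a b => ev u a *: b) (comul h)).
Definition rmul g : 'End(H) := linfun (fun h => h * g).
Definition rtrans g u : dual H := dual_of (fun h => ev u (h * g)).

Lemma linfunE (U V : vectType k) (f : U -> V) : linear f -> linfun f =1 f.
Proof.
move=> fL; pose g : {linear U -> V} := HB.pack f (GRing.isLinear.Build k U V *:%R f fL).
exact: (lfunE g).
Qed.

Lemma contractE u h : contract u h = tlift (fun a b => ev u a *: b) (comul h).
Proof. by apply: linfunE; apply: tlift_comulL. Qed.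

Lemma rmulE g h : rmul g h = h * g.
Proof. by apply: linfunE => c x y; rewrite mulrDl -scalerAl. Qed.

Lemma rtransE g u h : ev (rtrans g u) h = ev u (h * g).
Proof. by apply: dual_ofE => c x y; rewrite mulrDl -scalerAl linearP. Qed.

Lemma contract_is_linear : linear contract.
Proof.
move=> c u v; apply/lfunP=> h; rewrite add_lfunE scale_lfunE !contractE.
have FL (a b : H) : linear (fun u => ev u a *: b).
  by move=> d x y; rewrite dualD dualZ scalerDl scalerA.
exact: (@tlift_param _ _ _ (dual H) H (fun u a b => ev u a *: b) (comul h) FL).
Qed.

Lemma contract1 : contract 1 = \1%VF.
Proof.
apply/lfunP=> h; rewrite contractE id_lfunE -[RHS]counitl.
by apply: eq_tlift => a b; rewrite dual1E.
Qed.

Lemma contractM u v : contract (u * v) = (contract v \o contract u)%VF.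
Proof.
apply/lfunP=> h; rewrite comp_lfunE [LHS]contractE [contract u h]contractE.
transitivity (tlift (fun a b =>
    tlift (fun x y => (ev u x * ev v y) *: b) (comul a)) (comul h)).
  apply: eq_tlift => a b; rewrite dualM.
  rewrite (tlift_comp (W := k^o) _ _ (f := fun z : k => z *: b)) // => c x y.
  by rewrite scalerDl scalerA.
rewrite (@coassoc _ _ _ (fun x y b => (ev u x * ev v y) *: b)); last first.
  split=> [y z|x z|x y] c s t.
  - by rewrite linearP mulrDl scalerDl -mulrA scalerA.
  - by rewrite linearP mulrDr scalerDl mulrCA scalerA.
  - by rewrite scalerDr !scalerA mulrC.
rewrite [RHS](tlift_comp _ _ (f := contract v)); last first.
  by move=> c x y; rewrite linearP.
apply: eq_tlift => a b; rewrite linearZ /= contractE.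
rewrite (tlift_comp _ _ (f := fun x => ev u a *: x)) => [|c x y]; last first.
  by rewrite scalerDr !scalerA mulrC.
by apply: eq_tlift => x y; rewrite scalerA.
Qed.

Lemma ev_comulM (W : lmodType k) (B : H -> H -> W) g h : bilin B ->
  tlift B (comul (h * g)) =
  tlift (fun h1 h2 => tlift (fun g1 g2 => B (h1 * g1) (h2 * g2)) (comul g)) (comul h).
Proof.
move=> BB; have BL := tlift_is_linear B.
rewrite comulM (tlift_comp _ _ BL); apply: eq_tlift => a b.
rewrite (tlift_comp _ _ BL); apply: eq_tlift => x y.
by rewrite tlift_tpure.
Qed.

Lemma scale_bilin u : bilin (fun a b : H => ev u a *: b).
Proof.
split=> [b c x y|a c x y]; first by rewrite linearP scalerDl -scalerA.
by rewrite scalerDr; congr (_ + _); rewrite /= !scalerA mulrC.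
Qed.

(** By coassociativity the right side sends h to u(h_1 g_1) h_2 g_2 S(g_3), where g_2 and S(g_3)
    cancel by [antipoder]. It expresses a translate through multiplications, to which cyclicity of
    the trace applies. *)
Lemma contract_rtrans g u :
  contract (rtrans g u) =
  tlift (fun a b => (rmul (antipode b) \o contract u \o rmul a)%VF) (comul g).
Proof.
apply/lfunP=> h.
rewrite (tlift_comp _ _ (f := fun F : 'End(H) => F h)); last first.
  by move=> c x y; rewrite add_lfunE scale_lfunE.
pose T h1 h2 (x y z : H) := ev u (h1 * x) *: (h2 * y * antipode z).
have TT h1 h2 : trilin (T h1 h2).
  split=> [y z|x z|x y] c s t; rewrite /T.
  - by rewrite mulrDr -scalerAr linearP scalerDl scalerA.
  - by rewrite mulrDr -scalerAr mulrDl -scalerAl scalerDr !scalerA mulrC.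
  - by rewrite linearP mulrDr -scalerAr scalerDr !scalerA mulrC.
transitivity (tlift (fun a b => tlift (fun h1 h2 =>
    tlift (fun x y => T h1 h2 x y b) (comul a)) (comul h)) (comul g)); last first.
  apply: eq_tlift => a b.
  rewrite !comp_lfunE contractE !rmulE (ev_comulM _ _ (scale_bilin u)).
  rewrite (tlift_comp _ _ (f := fun x => x * antipode b)) => [|c x y]; last first.
    by rewrite mulrDl scalerAl.
  apply: eq_tlift => h1 h2.
  rewrite (tlift_comp _ _ (f := fun x => x * antipode b)) => [|c x y]; last first.
    by rewrite mulrDl scalerAl.
  by apply: eq_tlift => x y; rewrite -scalerAl.
rewrite contractE tlift_exchange; apply: eq_tlift => h1 h2.
rewrite (coassoc _ (TT h1 h2)) rtransE.
transitivity (tlift (fun a b => counit b *: (ev u (h1 * a) *: h2)) (comul g)).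
  rewrite -[in LHS](counitr g) (tlift_comp _ _ (f := fun x => ev u (h1 * x) *: h2)).
    by apply: eq_tlift => a b; rewrite -scalerAr linearZ scalerA.
  by move=> c x y; rewrite mulrDr -scalerAr linearP scalerDl scalerA.
apply: eq_tlift => a b; rewrite scalerA mulrC -scalerA.
rewrite -[h2 in LHS]mulr1 (scalerAr (counit b)) -antipoder.
rewrite (tlift_comp _ _ (f := fun x => ev u (h1 * a) *: (h2 * x))) => [|c x y].
  by apply: eq_tlift => x y; rewrite mulrA.
by rewrite mulrDr -scalerAr scalerDr !scalerA mulrC.
Qed.

(** The same cancellation of g_2 S(g_3), now in the second factor. It makes the radical of an
    invariant form stable under translations. *)
Lemma rtrans_mul g u v : rtrans g u * v =
  tlift (fun a b => rtrans a (u * rtrans (antipode b) v)) (comul g).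
Proof.
apply/dualP=> h; rewrite dualM.
rewrite (tlift_comp (W' := k^o) _ _ (f := fun w => ev w h)); last first.
  by move=> c x y; rewrite dualD dualZ.
pose T h1 h2 (x y z : H) : k^o := ev u (h1 * x) * ev v (h2 * y * antipode z).
have TT h1 h2 : trilin (T h1 h2).
  split=> [y z|x z|x y] c s t; rewrite /T.
  - by rewrite mulrDr -scalerAr linearP mulrDl -[c * _ * _]mulrA.
  - by rewrite mulrDr -scalerAr mulrDl -scalerAl linearP mulrDr mulrCA.
  - by rewrite linearP mulrDr -scalerAr linearP mulrDr mulrCA.
transitivity (tlift (fun a b => tlift (fun h1 h2 =>
    tlift (fun x y => T h1 h2 x y b) (comul a)) (comul h)) (comul g)); last first.
  apply: (@eq_tlift _ _ _ k^o) => a b.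
  rewrite rtransE dualM (ev_comulM _ _ (ev_bilin _ _)).
  apply: (@eq_tlift _ _ _ k^o) => h1 h2.
  by apply: (@eq_tlift _ _ _ k^o) => x y; rewrite rtransE.
rewrite tlift_exchange; apply: (@eq_tlift _ _ _ k^o) => h1 h2.
rewrite (coassoc _ (TT h1 h2)) rtransE.
transitivity (tlift (fun a b => counit b *: (ev u (h1 * a) * ev v h2 : k^o)) (comul g)).
  rewrite -[in LHS](counitr g).
  rewrite (tlift_comp (W' := k^o) _ _ (f := fun x => ev u (h1 * x) * ev v h2)).
    apply: (@eq_tlift _ _ _ k^o) => a b.
    by rewrite -scalerAr linearZ /= -mulrA.
  by move=> c x y; rewrite mulrDr -scalerAr linearP mulrDl -mulrA.
apply: (@eq_tlift _ _ _ k^o) => a b.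
rewrite -[h2 in LHS]mulr1 [_ *: _]mulrCA -linearZ (scalerAr (counit b)) -antipoder.
rewrite (tlift_comp (W' := k^o) _ _ (f := fun x => ev u (h1 * a) * ev v (h2 * x))).
  by apply: (@eq_tlift _ _ _ k^o) => x y; rewrite mulrA.
by move=> c x y; rewrite mulrDr -scalerAr linearP mulrDr mulrCA.
Qed.

End Regular.

Section Endomorphisms.
Variables (k : fieldType) (V : vectType k).
Implicit Types f g : 'End(V).

(** Matrices act on row vectors here, so [endmx] reverses composition. *)
Definition endmx f : 'M[k]_(\dim {:V}) := passmx.mxof (vbasis {:V}) (vbasis {:V}) f.
Definition etrace f : k := \tr (endmx f).

Lemma endmx_comp f g : endmx (f \o g)%VF = endmx g *m endmx f.
Proof. by apply: passmx.mxof_comp; apply: vbasisP. Qed.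

Lemma endmx1 : endmx \1%VF = 1%:M.
Proof. by apply: passmx.mxof1; apply/basis_free/vbasisP. Qed.

Lemma endmx_is_linear : linear endmx.
Proof. exact: passmx.mxof_linear. Qed.

Lemma etrace_is_scalar : scalar etrace.
Proof. by move=> c f g; rewrite /etrace endmx_is_linear linearP. Qed.

Lemma etraceC f g : etrace (f \o g)%VF = etrace (g \o f)%VF.
Proof. by rewrite /etrace !endmx_comp mxtrace_mulC. Qed.

End Endomorphisms.

(** * Nondegeneracy of the trace form *)

Section TraceForm.
Variables (k : fieldType) (H : finHopfType k).
Hypothesis mulC : commutative (@GRing.mul (dual H)).
Hypothesis char0 : [pchar k] =i pred0.
Implicit Types (u v w : dual H) (g h : H).

Let trc u : k := etrace (contract u).

Lemma trcL : scalar trc.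
Proof. by move=> c u v; rewrite /trc contract_is_linear etrace_is_scalar. Qed.

(** Cyclicity of the trace merges the two multiplications of [contract_rtrans] into one by S(g_2)
    g_1. Cocommutativity turns this into S(g_1) g_2, which is the scalar [counit g]. *)
Lemma etrace_rtrans g u : trc (rtrans g u) = counit g * trc u.
Proof.
have trL := @etrace_is_scalar k H.
rewrite /trc contract_rtrans (tlift_comp (W' := k^o) _ _ (f := @etrace k H)) //.
pose L x := etrace (contract u \o rmul x)%VF : k^o.
have LL : linear L.
  move=> c x y; rewrite /L -trL; apply: (congr1 (@etrace k H)); apply/lfunP=> h.
  by rewrite !(add_lfunE, scale_lfunE, comp_lfunE, rmulE) mulrDr -scalerAr linearP.
transitivity (tlift (fun a b => L (antipode b * a)) (comul g)).
  apply: (@eq_tlift _ _ _ k^o) => a b; rewrite etraceC comp_lfunA etraceC /L.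
  apply: (congr1 (@etrace k H)).
  by apply/lfunP=> h; rewrite !(comp_lfunE, rmulE) mulrA.
rewrite -(tlift_comp _ _ LL) (sweedlerC _ _ mulC) antipodel (linZ LL).
congr (_ * _); rewrite /L; apply: (congr1 (@etrace k H)).
by apply/lfunP=> h; rewrite comp_lfunE rmulE mulr1.
Qed.

(* The radical of the trace form is an ideal stable under right translations, so a
   nonzero element of it could be translated to be nonzero at 1, and the antipode
   would then put the unit, of trace dim H, in the radical. *)
Let null u := forall v, trc (u * v) = 0.

Let null_rtrans g u : null u -> null (rtrans g u).
Proof.
move=> u0 v; rewrite rtrans_mul (tlift_comp (W' := k^o) _ _ (f := trc)) /=; last first.
  exact: trcL.
rewrite (@eq_tlift _ _ _ k^o _ (fun _ _ => 0)) => [|a b].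
  by rewrite /tlift big1 // => i _; rewrite big1 // => j _; rewrite scaler0.
by rewrite etrace_rtrans u0 mulr0.
Qed.

Let null1 u : null u -> ev u 1 = 0.
Proof.
move=> u0; pose S i : dual H := dual_of (fun h => ev (dual_coord i) (antipode h)).
have SE i h : ev (S i) h = ev (dual_coord i) (antipode h).
  by apply: dual_ofE => c x y; rewrite !linearP.
(* Expanding S(h_2) in the basis in the identity u(h_1 S(h_2)) = u(1) counit(h) places a multiple of
   the unit in the ideal generated by the translates of [u]. *)
have Eu : \sum_(i < \dim {:H}) rtrans (vbasis {:H})`_i u * S i = ev u 1 *: 1.
  apply/dualP=> h; rewrite dual_sum dualZ dual1E.
  transitivity (tlift (fun a b => ev u (a * antipode b) : k^o) (comul h)).
    under eq_bigr => l _ do rewrite dualM /tlift.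
    rewrite exchange_big /tlift; apply: eq_bigr => i _ /=.
    rewrite exchange_big; apply: eq_bigr => j _ /=.
    rewrite -(scaler_sumr (V := k^o)); congr (_ * _).
    rewrite [antipode _ in RHS](coord_vbasis (memvf _)) mulr_sumr linear_sum /=.
    apply: eq_bigr => l _; rewrite rtransE SE dual_coordE.
    by rewrite -scalerAr linearZ /= mulrC.
  rewrite -(tlift_comp (W' := k^o) _ _ (f := ev u)); last exact: evL.
  by rewrite antipoder linearZ /= mulrC.
have trcZ := linZ (trcL : linear (trc : dual H -> k^o)).
have : trc (ev u 1 *: 1) = 0.
  rewrite -Eu (lin_sum (trcL : linear (trc : dual H -> k^o))) big1 // => i _.
  exact: null_rtrans.
(* The unit acts as the identity, whose trace [\dim {:H}] is nonzero in characteristic 0. *)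
rewrite trcZ /trc contract1 /etrace endmx1 mxtrace1 => /eqP.
rewrite mulf_eq0 => /orP[/eqP //|/eqP n0].
have : \dim {:H} != 0%N.
  rewrite dimv_eq0 -subv0; apply/negP=> /subvP/(_ 1 (memvf _)).
  by rewrite memv0 oner_eq0.
by rewrite -((pcharf0P k).1 char0) n0 eqxx.
Qed.

(** The value of [u] at [g] is the value at 1 of its translate by [g], which stays in the
    radical. *)
Lemma trace_form_nondegenerate u : (forall v, trc (u * v) = 0) -> u = 0.
Proof.
move=> u0; apply/dualP=> g; rewrite dual0 -[g]mul1r -rtransE.
exact/null1/null_rtrans.
Qed.

End TraceForm.

Definition grouplike (k : fieldType) (H : finHopfType k) (g : H) :=
  comul g = tpure g g /\ counit g = 1.

(** * A basis of grouplike elements *)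

Section GrouplikeBasis.
Variables (k : closedFieldType) (H : finHopfType k).
Hypothesis mulC : commutative (@GRing.mul (dual H)).
Hypothesis char0 : [pchar k] =i pred0.
Implicit Types (u v w : dual H) (g h : H).
Local Notation n := (\dim {:H}).
Local Notation e := (vbasis {:H}).

Let mx u : 'M[k]_n := endmx (contract u).

(** Both [contract] and [endmx] reverse products, and the two reversals cancel. *)
Let mxM u v : mx (u * v) = mx u *m mx v.
Proof. by rewrite /mx contractM endmx_comp. Qed.

(** The matrices [mx v] form an algebra without nonzero nilpotents: if [mx v] is nilpotent, so is
    every [mx (v * w)] by commutativity, hence all traces vanish and [v] lies in the radical of the
    trace form. *)
Lemma diagonalizable_contract u : diagonalizable (endmx (contract u)).
Proof.
apply: (@diagonalizable_reduced _ _ (fun A => exists v, A = mx v)); last by exists u.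
- by exists 1; rewrite /mx contract1 endmx1.
- move=> c _ _ [v ->] [w ->]; exists (c *: v + w).
  by rewrite /mx contract_is_linear endmx_is_linear.
- by move=> _ _ [v ->] [w ->]; exists (v * w); rewrite mxM.
move=> _ m [v ->] vm0; rewrite (_ : v = 0) ?/mx.
  by rewrite (lin0 (@contract_is_linear _ _)) (lin0 (@endmx_is_linear _ _)).
apply: (trace_form_nondegenerate mulC char0) => w.
apply: (@mxtrace_nilpotent _ _ _ m); rewrite -/(mx _) mxM.
rewrite [_ *m _](erefl : _ = mx v * mx w) exprMn_comm ?vm0 ?mul0r //.
by rewrite /GRing.comm -[LHS]mxM mulC mxM.
Qed.

Lemma counit_contract u h : counit (contract u h) = ev u h.
Proof.
rewrite contractE (tlift_comp (W' := k^o) _ _ (f := counit)); last first.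
  by move=> c x y; rewrite linearP.
rewrite -[in RHS](counitr h) (tlift_comp (W' := k^o) _ _ (f := ev u)); last exact: evL.
by apply: (@eq_tlift _ _ _ k^o) => a b; rewrite !linearZ /= mulrC.
Qed.

(** Applying [counit] to the eigenvalue equations shows that coordinate [i] of [h] is its eigenvalue
    times [counit h]. If [counit h] vanished, so would [h]; once it is scaled to 1, eigenvalues are
    coordinates and the equations give the entries of [comul]. *)
Lemma eigen_grouplike h : h != 0 ->
  (forall i, exists d, contract (dual_coord i) h = d *: h) ->
  counit h != 0 /\ grouplike ((counit h)^-1 *: h).
Proof.
move=> h0 eig.
have ev_h i d : contract (dual_coord i) h = d *: h -> ev (dual_coord i) h = d * counit h.
  by move=> Ed; rewrite -counit_contract Ed linearZ.
have eps0 : counit h != 0.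
  apply: contra_neq h0 => eps0; rewrite (coord_vbasis (memvf h)) big1 // => i _.
  by have [d /ev_h] := eig i; rewrite dual_coordE eps0 mulr0 => ->; rewrite scale0r.
split=> //; split; last by rewrite linearZ /= mulVf.
apply/matrixP=> i j; rewrite mxE -tens_coordE.
transitivity (ev (dual_coord j) (contract (dual_coord i) ((counit h)^-1 *: h))).
  rewrite contractE (tlift_comp (W' := k^o) _ _ (f := ev (dual_coord j))); last exact: evL.
  by apply: (@eq_tlift _ _ _ k^o) => a b; rewrite linearZ.
have [d Ed] := eig i; rewrite linearZ /= Ed -!dual_coordE !linearZ /= (ev_h _ _ Ed).
by rewrite mulrCA; congr (_ * _); rewrite mulrC mulfK.
Qed.

(** The contractions commute and are diagonalizable, so they have a common eigenbasis, given by the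
    rows of [P]; each eigenvector is then normalized. *)
Lemma grouplike_basis :
  exists2 b : n.-tuple H, basis_of {:H} b & forall i : 'I_n, grouplike b`_i.
Proof.
have eb := vbasisP {:H}.
have /codiagonalizableP [P Pu /allP/= Pd] :
    {in [seq mx (dual_coord i) | i : 'I_n] &, forall A B, comm_mx A B} /\
    {in [seq mx (dual_coord i) | i : 'I_n], forall A, diagonalizable A}.
  split=> [_ _ /mapP[i _ ->] /mapP[j _ ->]|_ /mapP[i _ ->]].
    by rewrite /comm_mx -!mxM mulC.
  exact: diagonalizable_contract.
pose x i := passmx.vecof e (row i P).
have x0 i : x i != 0.
  rewrite passmx.vecof_eq0 //; apply: contraTneq Pu => Pi0.
  rewrite -row_free_unit; apply/negP=> /row_freeP[Q PQ].
  have /eqP := congr1 (fun A : 'M_n => A i i) PQ.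
  have -> : (P *m Q) i i = (row i P *m Q) 0 i by rewrite -row_mul [RHS]mxE.
  by rewrite Pi0 mul0mx !mxE eqxx eq_sym oner_eq0.
have xe i j : exists d, contract (dual_coord j) (x i) = d *: x i.
  have /Pd/diagonalizable_forPex[D /(simmxP Pu) PD] :
    mx (dual_coord j) \in [seq mx (dual_coord j) | j : 'I_n].
    by apply/mapP; exists j; rewrite ?mem_enum.
  exists (D 0 i); rewrite /x (passmx.hom_vecof _ eb) -/(endmx _) -/(mx _) -row_mul PD.
  by rewrite row_mul row_diag_mx -scalemxAl -rowE (linZ (passmx.vecof_linear _)).
have gl i := eigen_grouplike (x0 i) (xe i).
pose b := [tuple (counit (x i))^-1 *: x i | i < n].
exists b => [|i]; last by rewrite -tnth_nth tnth_mktuple; case: (gl i).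
rewrite basisEfree subvf size_tuple leqnn !andbT; apply/freeP => c.
rewrite (eq_bigr (fun i => c i *: ((counit (x i))^-1 *: x i))) => [|i _]; last first.
  by rewrite -tnth_nth tnth_mktuple.
(* The normalizing factors are absorbed into the coefficients, so that independence reduces to
   invertibility of [P]. *)
pose y : 'rV[k]_n := \row_i (c i * (counit (x i))^-1).
have -> : \sum_(i < n) c i *: ((counit (x i))^-1 *: x i) = passmx.vecof e (y *m P).
  rewrite mulmx_sum_row (lin_sum (passmx.vecof_linear _)) /=; apply: eq_bigr => i _.
  by rewrite (linZ (passmx.vecof_linear _)) mxE scalerA.
move/eqP; rewrite passmx.vecof_eq0 // => /eqP yP i.
have /rowP/(_ i)/eqP : y = 0 by rewrite -[y](mulmxK Pu) yP mul0mx.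
by rewrite !mxE mulf_eq0 invr_eq0 (negPf (gl i).1) orbF => /eqP.
Qed.

End GrouplikeBasis.

(** * The group formed by a grouplike basis *)

Section GroupOfGrouplikes.
Variables (k : fieldType) (H : finHopfType k) (n : nat) (b : n.-tuple H).
Hypothesis bB : basis_of {:H} b.
Hypothesis bG : forall i : 'I_n, grouplike b`_i.
Implicit Types (g h : H) (i j : 'I_n).

Lemma basis_ext (W : lmodType k) (f g : H -> W) : linear f -> linear g ->
  (forall i, f b`_i = g b`_i) -> f =1 g.
Proof.
move=> fL gL fg h; rewrite (coord_basis bB (memvf h)) (lin_sum fL) (lin_sum gL).
by apply: eq_bigr => i _; rewrite (linZ fL) (linZ gL) fg.
Qed.

Let coord_b i j : coord b i b`_j = (i == j)%:R.
Proof. by rewrite coord_free ?(basis_free bB) // eq_sym. Qed.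

Let b_inj i j : b`_i = b`_j -> i = j.
Proof.
move/(congr1 (coord b i)); rewrite !coord_b eqxx.
by case: (i =P j) => // _ /eqP; rewrite oner_eq0.
Qed.

(** The coordinate forms are orthogonal idempotents of the dual, and evaluation at [g] is a
    character of it. Hence a single coordinate of [g] is nonzero, and it equals 1. *)
Lemma grouplike_in_basis g : grouplike g -> exists i, g = b`_i.
Proof.
case=> gD gE; pose u i := dual_of (coord b i).
have uE i h : ev (u i) h = coord b i h by apply: dual_ofE => c x y; rewrite linearP.
have cM i j : coord b i g * coord b j g = (i == j)%:R * coord b i g.
  transitivity (ev (u i * u j) g).
    by rewrite dualM gD (tlift_tpure (W := k^o)) ?uE //; apply: ev_bilin.
  rewrite {1}(coord_basis bB (memvf g)) linear_sum (bigD1 i) //= linearZ /=.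
  have Eu (l : 'I_n) : ev (u i * u j) b`_l = (i == l)%:R * (j == l)%:R.
    by rewrite dualM (bG l).1 (tlift_tpure (W := k^o)) ?uE ?coord_b //; apply: ev_bilin.
  rewrite Eu eqxx mul1r big1 => [|l il]; first by rewrite addr0 mulrC eq_sym.
  by rewrite linearZ /= Eu eq_sym (negPf il) mul0r mulr0.
have [i ci0] : exists i, coord b i g != 0.
  apply/existsP; apply: contraT; rewrite negb_exists => /forallP c0.
  move: gE; rewrite (coord_basis bB (memvf g)) linear_sum big1 => [|i _].
    by move/esym/eqP; rewrite oner_eq0.
  by have /negPn/eqP -> := c0 i; rewrite linearZ /= mul0r.
have ci1 : coord b i g = 1.
  by apply: (mulfI ci0); rewrite cM eqxx mul1r mulr1.
exists i; rewrite [LHS](coord_basis bB (memvf g)) (bigD1 i) //= ci1 scale1r.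
rewrite big1 ?addr0 // => j ji; have := cM i j.
by rewrite ci1 mul1r eq_sym (negPf ji) mul0r => ->; rewrite scale0r.
Qed.

Lemma grouplikeM g h : grouplike g -> grouplike h -> grouplike (g * h).
Proof.
case=> gD gE [hD hE]; split; last by rewrite counitM gE hE mulr1.
have E := tpure_bilin H H.
rewrite (comulM g h) gD tlift_tpure.
  rewrite hD tlift_tpure //.
  by split=> [x c y z|x c y z]; rewrite mulrDr -scalerAr E.
split=> [x c y z|x c y z].
  apply: (@tlift_param k H H H _ (fun s u v => tpure (s * u) (x * v))) => u v d s t.
  by rewrite mulrDl -scalerAl E.
apply: (@tlift_param k H H H _ (fun s u v => tpure (x * u) (s * v))) => u v d s t.
by rewrite mulrDl -scalerAl E.
Qed.

Lemma grouplike1 : grouplike (1 : H).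
Proof. by split; [apply: comul1 | apply: counit1]. Qed.

Lemma grouplike_antipode g : grouplike g -> antipode g * g = 1.
Proof.
case=> gD gE; have := antipodel g; rewrite gD gE scale1r tlift_tpure //.
split=> [x c y z|x c y z]; last by rewrite mulrDr -scalerAr.
by rewrite linearP mulrDl -scalerAl.
Qed.

(** The basis exhausts the grouplike elements, so it is closed under products and its index set
    inherits a group law; taking coordinates is the isomorphism. *)
Lemma group_alg_iso : exists (gT : finGroupType) (f : H -> group_alg k gT), hopf_iso f.
Proof.
have /fin_all_exists[m mE] (p : 'I_n * 'I_n) : exists l : 'I_n, b`_p.1 * b`_p.2 = b`_l.
  exact/grouplike_in_basis/grouplikeM.
have [o oE] := grouplike_in_basis grouplike1.
have m_inj i : injective (fun j => m (i, j)).
  move=> j l /(congr1 (fun x : 'I_n => antipode b`_i * b`_x)).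
  by rewrite -!mE /= !mulrA grouplike_antipode // !mul1r => /b_inj.
(* Left multiplication by a basis element is injective on the finite index set, hence bijective; the
   inverse of [i] is the index that it sends to [o]. *)
pose v i := invF (m_inj i) o.
have vE i : b`_i * b`_(v i) = 1.
  by rewrite (mE (i, v i)) oE /v (f_invF (m_inj i)).
have vS i : antipode b`_i = b`_(v i).
  by rewrite -[LHS]mulr1 -(vE i) mulrA grouplike_antipode // mul1r.
pose mul i j := m (i, j).
have mulE i j : b`_(mul i j) = b`_i * b`_j by rewrite -(mE (i, j)).
have mA : associative mul by move=> i j l; apply: b_inj; rewrite !mulE mulrA.
have m1 : left_id o mul by move=> i; apply: b_inj; rewrite mulE -oE mul1r.
have mV : left_inverse o v mul.
  by move=> i; apply: b_inj; rewrite mulE -vS grouplike_antipode // oE.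
pose gT : finGroupType :=
  HB.pack_for finGroupType 'I_n (Finite_isGroup.Build 'I_n mA m1 mV).
exists gT; pose f h : group_alg k gT := [ffun i : 'I_n => coord b i h : k^o].
have fL : linear f by move=> c x y; apply/ffunP=> i; rewrite !ffunE linearP.
have fb (i : gT) : f b`_(i : 'I_n) = @gdelta k gT i.
  by apply/ffunP=> j; rewrite !ffunE coord_b.
pose g : group_alg k gT -> H := glift (fun i : gT => b`_(i : 'I_n)).
have gL : linear g by apply: glift_is_linear.
have gb (i : gT) : g (gdelta k i) = b`_(i : 'I_n) by apply: glift_delta.
exists f; split=> //.
- exists g.
    by apply: basis_ext => [c x y|//|i]; rewrite ?fL ?gL // (fb i) gb.
  by apply: galg_ext => [c x y|//|i]; rewrite ?gL ?fL // gb fb.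
- by rewrite oE (fb o).
- move=> x y; move: x; apply: basis_ext => [c x z|c x z|i].
  + by rewrite mulrDl -scalerAl fL.
  + by rewrite fL mulrDl -scalerAl.
  move: y; apply: basis_ext => [c x z|c x z|j].
  + by rewrite mulrDr -scalerAr fL.
  + by rewrite fL mulrDr -scalerAr.
  by rewrite -mulE !fb gdeltaM.
- apply: basis_ext => [c x y|c x y|i].
  + by rewrite fL linearP.
  + by rewrite linearP tmap_is_linear.
  rewrite fb (bG i).1 tmap_tpure // fb; exact: galg_comul_delta.
- apply: (@basis_ext k^o) => [c x y|c x y|i].
  + by rewrite fL linearP.
  + by rewrite linearP.
  by rewrite fb (bG i).2; apply: galg_counit_delta.
apply: basis_ext => [c x y|c x y|i].
- by rewrite fL linearP.
- by rewrite linearP fL.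
by rewrite fb vS fb; apply: galg_antipode_delta.
Qed.

End GroupOfGrouplikes.

Theorem cocommutative_group_alg (k : closedFieldType) (H : finHopfType k) :
  [pchar k] =i pred0 -> commutative (@GRing.mul (dual H)) ->
  exists (gT : finGroupType) (f : H -> group_alg k gT), hopf_iso f.
Proof.
move=> char0 mulC; have [b bB bG] := grouplike_basis mulC char0.
exact: group_alg_iso bB bG.
Qed.

(** * Annihilators of subalgebras of the dual *)

Lemma tlift_mem (k : fieldType) (U V W : vectType k) (B : U -> V -> W)
    (J : {vspace W}) t :
  (forall a b, B a b \in J) -> tlift B t \in J.
Proof.
by move=> BJ; apply: memv_suml => i _; apply: memv_suml => j _; apply: memvZ.
Qed.

Lemma tens_space_mem (k : fieldType) (U V W : vectType k) (A : {vspace U})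
    (B : {vspace V}) (J : {vspace W}) (f : tens U V -> W) t : linear f ->
  (forall a b, a \in A -> b \in B -> f (tpure a b) \in J) ->
  t \in tens_space A B -> f t \in J.
Proof.
move=> fL fJ; rewrite /tens_space; set s := [seq _ | a <- _, b <- _].
move/(@coord_span _ _ _ (in_tuple s)) => ->; rewrite (lin_sum fL) memv_suml // => i _.
have /allpairsP[[a b] /= [aA bB sE]] : s`_i \in s by rewrite mem_nth.
by rewrite (linZ fL) memvZ //= sE fJ ?vbasis_mem.
Qed.

Section Annihilators.
Variables (k : fieldType) (H : finHopfType k).
Implicit Types (u v w : dual H) (g h x : H) (A : {vspace dual H}) (I : {vspace H}).

Definition tens_ideal I : {vspace tens H H} :=
  (tens_space I {:H} + tens_space {:H} I)%VS.

Lemma tens_ideal_ind (W : vectType k) I (J : {vspace W}) (f : tens H H -> W) t :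
  linear f -> (forall a b, a \in I -> f (tpure a b) \in J) ->
  (forall a b, b \in I -> f (tpure a b) \in J) -> t \in tens_ideal I -> f t \in J.
Proof.
move=> fL fl fr /memv_addP[s sI [r rI ->]]; rewrite (linD fL) memvD //.
  by apply: tens_space_mem sI => // a b aI _; apply: fl.
by apply: tens_space_mem rI => // a b _; apply: fr.
Qed.

Lemma mem_tens_ideall I x h : x \in I -> tpure x h \in tens_ideal I.
Proof. by move=> xI; apply/(subvP (addvSl _ _))/tpure_space; rewrite ?memvf. Qed.

Lemma mem_tens_idealr I x h : x \in I -> tpure h x \in tens_ideal I.
Proof. by move=> xI; apply/(subvP (addvSr _ _))/tpure_space; rewrite ?memvf. Qed.

Lemma tens_idealP I t :
  (forall u v, (forall x, x \in I -> ev u x = 0) -> (forall x, x \in I -> ev v x = 0) ->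
     tlift (fun a b => ev u a * ev v b : k^o) t = 0) ->
  t \in tens_ideal I.
Proof.
move=> uv0; pose p := daddv_pi I^C I.
have capCI : (I^C :&: I = 0)%VS by rewrite capvC capv_compl.
have pL : linear p by move=> c x y; rewrite linearP.
have pB x : x - p x \in I.
  rewrite -{1}(daddv_pi_add capCI (w := x)) ?[p x + _]addrC ?addrK ?memv_pi //.
  by rewrite addvC addv_complf memvf.
have p0 x : x \in I -> p x = 0.
  move=> xI; apply/eqP; rewrite -memv0 -capCI memv_cap memv_pi /=.
  by rewrite -[p x](subKr x) memvB.
have tp0 : tmap p p t = 0.
  apply/matrixP=> i j; rewrite mxE -tens_coordE.
  rewrite (@tlift_tmap _ _ _ _ _ _ _ k^o); last exact: ev_bilin.
  pose u i := dual_of (fun h => ev (dual_coord i) (p h)).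
  have uE l h : ev (u l) h = ev (dual_coord l) (p h).
    by apply: dual_ofE => c x y; rewrite pL linearP.
  rewrite -[RHS](uv0 (u i) (u j)).
  - by apply: (@eq_tlift _ _ _ k^o) => a b; rewrite !uE.
  - by move=> x xI; rewrite uE p0 ?linear0.
  - by move=> x xI; rewrite uE p0 ?linear0.
have E := tpure_bilin H H.
rewrite -[t]subr0 -tp0 -{1}[t]tlift_id /tmap /tlift -sumrB memv_suml // => i _.
rewrite -sumrB memv_suml // => j _; rewrite -scalerBr memvZ //.
set a := _`_i; set b := _`_j.
rewrite (_ : _ - _ = tpure (a - p a) b + tpure (p a) (b - p b)).
  by apply: memvD; [apply/mem_tens_ideall/pB | apply/mem_tens_idealr/pB].
by rewrite (linB (E.1 _)) (linB (E.2 _)) addrA subrK.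
Qed.

Definition annmap A : 'Hom(H, 'rV[k]_(\dim A)) :=
  linfun (fun h => \row_i ev (vbasis A)`_i h).
Definition ann A : {vspace H} := lker (annmap A).

Lemma annmapE A h : annmap A h = \row_i ev (vbasis A)`_i h.
Proof. by apply: linfunE => c x y; apply/rowP=> i; rewrite !mxE linearP. Qed.

Lemma annP A h : reflect (forall u, u \in A -> ev u h = 0) (h \in ann A).
Proof.
rewrite memv_ker annmapE; apply: (iffP eqP) => [h0 u uA|h0].
  rewrite (coord_vbasis uA) dual_sum big1 // => i _.
  by rewrite dualZ; have /rowP/(_ i) := h0; rewrite !mxE => ->; rewrite mulr0.
by apply/rowP=> i; rewrite !mxE h0 // vbasis_mem // mem_nth ?size_tuple.
Qed.

(** A form vanishing on the kernel of [annmap A] factors through [annmap A]. The factoring form has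
    coordinates [c], read off through a generalized inverse, and these are the coefficients of [u]
    in the basis of [A]. *)
Lemma ann_ann A u : (forall h, h \in ann A -> ev u h = 0) -> u \in A.
Proof.
move=> u0; pose c i := ev u ((annmap A)^-1%VF (delta_mx 0 i)).
suff -> : u = \sum_i c i *: (vbasis A)`_i.
  by apply: memv_suml => i _; rewrite memvZ // vbasis_mem // mem_nth ?size_tuple.
apply/dualP=> h; have : ev u (h - (annmap A)^-1%VF (annmap A h)) = 0.
  apply: u0; rewrite memv_ker linearB /= subr_eq0.
  by rewrite limg_lfunVK // memv_img ?memvf.
rewrite linearB => /eqP; rewrite subr_eq0 => /eqP ->.
rewrite [annmap A h]row_sum_delta !linear_sum dual_sum; apply: eq_bigr => i _.
by rewrite !linearZ /= dualZ annmapE mxE mulrC.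
Qed.

(* The map sending x (x) y to x y_1 (x) y_2 is injective and preserves
   I (x) H + H (x) I, hence so does its inverse, which sends 1 (x) x to
   S(x_1) (x) x_2; apply id (x) counit. *)
Lemma biideal_antipode I :
  (forall a x, x \in I -> a * x \in I) -> (forall a x, x \in I -> x * a \in I) ->
  (forall x, x \in I -> comul x \in tens_ideal I) ->
  (forall x, x \in I -> counit x = 0) ->
  forall x, x \in I -> antipode x \in I.
Proof.
move=> Il Ir Id Ie x xI; have E := tpure_bilin H H.
(* The parameter [s] is the identity for the map itself and [antipode] for its inverse. *)
pose can_ (s : H -> H) (t : tens H H) : tens H H :=
  tlift (fun x y => tlift (fun a b => tpure (x * s a) b) (comul y)) t.
have canL s : linear (can_ s) by apply: tlift_is_linear.
have mulB (s : H -> H) y : linear s -> bilin (fun a b : H => tpure (y * s a) b).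
  move=> sL; split=> [b c a a'|a c b b']; last by rewrite E.
  by rewrite sL mulrDr -scalerAr E.
have can_pure s a b : linear s -> can_ s (tpure a b) =
    tlift (fun c d => tpure (a * s c) d) (comul b).
  move=> sL; rewrite /can_ tlift_tpure //; split=> [y|y]; last exact: tlift_comulL.
  apply: (@tlift_param k H H H _ (fun z c d => tpure (z * s c) d)) => c d e z z'.
  by rewrite mulrDl -scalerAl E.
have idL : linear (@id H) by [].
have SL : linear (antipode : H -> H) by move=> c y z; rewrite linearP.
have canK : cancel (can_ id) (can_ antipode).
  move=> t; rewrite -[RHS]tlift_id -{1}[t]tlift_id !(tlift_comp _ _ (canL _)).
  apply: eq_tlift => a b; rewrite can_pure // (tlift_comp _ _ (canL _)).
  transitivity (tlift (fun c d => tlift (fun d1 d2 => tpure (a * c * antipode d1) d2)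
      (comul d)) (comul b)).
    by apply: eq_tlift => c d; rewrite can_pure.
  rewrite -(@coassoc _ _ _ (fun c d1 d2 => tpure (a * c * antipode d1) d2)); last first.
    split=> [y z|y z|y z] c p q.
    - by rewrite mulrDr -scalerAr mulrDl -scalerAl E.
    - by rewrite linearP mulrDr -scalerAr E.
    - by rewrite E.
  rewrite -[in RHS](counitl b) (tlift_comp _ _ (E.2 a)); apply: eq_tlift => c d.
  rewrite (linZ (E.2 a)) -(linZ (E.1 d)) -[a in RHS]mulr1 scalerAr -antipoder.
  rewrite (tlift_comp _ _ (f := fun z => tpure (a * z) d)) => [|e y z].
    by apply: eq_tlift => y z; rewrite mulrA.
  by rewrite mulrDr -scalerAr E.
pose F : 'End(tens H H) := linfun (can_ id).
have FE t : F t = can_ id t by apply: linfunE.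
have FJ : (F @: tens_ideal I <= tens_ideal I)%VS.
  apply/subvP=> _ /memv_imgP[t tJ ->]; rewrite FE.
  apply: tens_ideal_ind tJ => // a b ab; rewrite can_pure //.
    by apply: tlift_mem => c d; apply/mem_tens_ideall/Ir.
  pose G (t : tens H H) : tens H H := tlift (fun c d => tpure (a * c) d) t.
  apply: (@tens_ideal_ind _ I (tens_ideal I) G); last exact: Id.
  - exact: tlift_is_linear.
  - move=> c d cI; rewrite /G tlift_tpure ?mem_tens_ideall ?Il //.
    exact: (mulB id).
  - move=> c d dI; rewrite /G tlift_tpure ?mem_tens_idealr //.
    exact: (mulB id).
have F0 : (tens_ideal I :&: lker F = 0)%VS.
  apply/eqP; rewrite -subv0; apply/subvP=> t /memv_capP[_].
  rewrite memv_ker memv0 FE => /eqP t0.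
  by rewrite -[t]canK t0 (lin0 (canL _)).
(* An injective map of a finite-dimensional space into itself is onto, by dimension. *)
have FI : (F @: tens_ideal I)%VS = tens_ideal I.
  by apply/eqP; rewrite eqEdim FJ /= -(limg_ker_dim F) F0 dimv0 add0n.
have : tpure 1 x \in (F @: tens_ideal I)%VS by rewrite FI mem_tens_idealr.
case/memv_imgP=> t tJ; rewrite FE => /(congr1 (can_ antipode)); rewrite canK can_pure //.
move=> Et; pose G (s : tens H H) : H := tlift (fun a b => counit b *: a) s.
have GB : bilin (fun a b : H => counit b *: a).
  split=> [b c y z|a c y z]; last by rewrite linearP scalerDl -scalerA.
  by rewrite scalerDr; congr (_ + _); rewrite /= !scalerA mulrC.
have : G t \in I.
  apply: tens_ideal_ind tJ => [|a b aI|a b bI]; first exact: tlift_is_linear.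
    by rewrite /G tlift_tpure // memvZ.
  by rewrite /G tlift_tpure // Ie // scale0r mem0v.
suff -> : G t = antipode x by [].
rewrite -Et (tlift_comp (f := G)); last exact: tlift_is_linear.
rewrite -[in RHS](counitr x) (tlift_comp _ _ SL); apply: eq_tlift => a b.
by rewrite /G tlift_tpure // mul1r linearZ.
Qed.

Definition ltrans g u : dual H := dual_of (fun h => ev u (g * h)).

Lemma ltransE g u h : ev (ltrans g u) h = ev u (g * h).
Proof. by apply: dual_ofE => c x y; rewrite mulrDr -scalerAr linearP. Qed.

(** Stability of [A] under translations makes the annihilator a two-sided ideal, closure under
    products makes it a coideal, and the unit of [A] is the counit. The antipode condition then
    follows from [biideal_antipode]. *)
Lemma ann_hopf_ideal (A : {aspace dual H}) : 1 \in A ->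
  (forall g u, u \in A -> rtrans g u \in A) -> (forall g u, u \in A -> ltrans g u \in A) ->
  exists I : hopf_ideal H, I = ann A :> {vspace H}.
Proof.
move=> A1 shA lshA; pose I := ann A.
have Il a x : x \in I -> a * x \in I.
  by move/annP=> x0; apply/annP=> u uA; rewrite -ltransE x0 ?lshA.
have Ir a x : x \in I -> x * a \in I.
  by move/annP=> x0; apply/annP=> u uA; rewrite -rtransE x0 ?shA.
have Id x : x \in I -> comul x \in tens_ideal I.
  move=> /annP x0; apply: tens_idealP => u v /ann_ann uA /ann_ann vA.
  by rewrite -dualM x0 // memvM.
have Ie x : x \in I -> counit x = 0.
  by move=> /annP x0; rewrite -dual1E x0.
by exists (HopfIdeal Il Ir Id Ie (biideal_antipode Il Ir Id Ie)).
Qed.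

(** The generated algebra is a sum of powers of the span of [X], so [P] is propagated through spans,
    powers and sums. *)
Lemma agenv_ind (P : dual H -> Prop) (X : seq (dual H)) : P 1 ->
  (forall c u v, P u -> P v -> P (c *: u + v)) -> (forall u v, P u -> P v -> P (u * v)) ->
  (forall u, u \in X -> P u) -> forall u, u \in (<< <<X>> >>)%AS -> P u.
Proof.
move=> P1 PL PM PX.
have P0 : P 0 by have := PL (-1) 1 1 P1 P1; rewrite scaleN1r addNr.
have PS (I : Type) (r : seq I) (Q : pred I) (F : I -> dual H) :
    (forall i, Q i -> P (F i)) -> P (\sum_(i <- r | Q i) F i).
  by move=> PF; elim/big_rec: _ => // i v Qi Pv; rewrite -[F i]scale1r; apply/PL/Pv/PF.
have PZ c u : P u -> P (c *: u) by move=> Pu; rewrite -[_ *: _]addr0; apply: PL.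
have Pspan (s : seq (dual H)) :
    (forall u, u \in s -> P u) -> forall u, u \in <<s>>%VS -> P u.
  move=> Ps u /(@coord_span _ _ _ (in_tuple s)) ->; apply: PS => i _.
  by apply/PZ/Ps/mem_nth.
have Pexp m u : u \in (<<X>> ^+ m)%VS -> P u.
  elim: m u => [|m IHm] u; first by rewrite expv0 => /vlineP[c ->]; apply: PZ.
  rewrite expvSl /prodv unlock; apply: (Pspan) => _ /allpairsP[[a b] /= [aX bX ->]].
  by apply: PM; [apply/(Pspan X)/vbasis_mem | apply/IHm/vbasis_mem].
by move=> u /memv_sumP[F FX ->]; apply: PS => i _; apply: Pexp (FX i isT).
Qed.

End Annihilators.

(** * Poisson actions on the polynomial algebra in two variables *)

Lemma tlift_sum (k : fieldType) (U V : vectType k) (W : lmodType k) (I : finType)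
    (F : I -> U -> V -> W) t :
  tlift (fun a b => \sum_i F i a b) t = \sum_i tlift (F i) t.
Proof.
rewrite /tlift [RHS]exchange_big; apply: eq_bigr => i _ /=.
rewrite [RHS]exchange_big; apply: eq_bigr => j _ /=.
by rewrite scaler_sumr.
Qed.

(** This turns compatibility of the action with a bilinear operation into identities between
    products of coefficients in the dual. *)
Lemma sweedler_sum (k : fieldType) (H : finHopfType k) (V W : lmodType k)
    (B : V -> V -> W) (F G : H -> V) (I J : finType) (u : I -> dual H) (p : I -> V)
    (v : J -> dual H) (q : J -> V) h : bilin B ->
  (forall x, F x = \sum_i ev (u i) x *: p i) ->
  (forall x, G x = \sum_j ev (v j) x *: q j) ->
  tlift (fun a b => B (F a) (G b)) (comul h) =
  \sum_i \sum_j ev (u i * v j) h *: B (p i) (q j).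
Proof.
move=> [Bl Br] FE GE.
transitivity (tlift (fun a b => \sum_i \sum_j (ev (u i) a * ev (v j) b) *: B (p i) (q j))
  (comul h)).
  apply: eq_tlift => a b; rewrite FE GE (lin_sum (Bl _)); apply: eq_bigr => i _.
  rewrite (linZ (Bl _)) (lin_sum (Br _)) scaler_sumr; apply: eq_bigr => j _.
  by rewrite (linZ (Br _)) scalerA.
rewrite tlift_sum; apply: eq_bigr => i _; rewrite tlift_sum; apply: eq_bigr => j _.
rewrite dualM (tlift_comp (W := k^o) _ _ (f := fun z : k => z *: B (p i) (q j))) //.
by move=> c x y; rewrite scalerDl scalerA.
Qed.

(** Explicit ordinals, so that comparisons reduce by computation after [ord3P]. *)
Definition o0 : 'I_3 := Ordinal (isT : 0 < 3)%N.
Definition o1 : 'I_3 := Ordinal (isT : 1 < 3)%N.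
Definition o2 : 'I_3 := Ordinal (isT : 2 < 3)%N.

Lemma sum3 (V : nmodType) (F : 'I_3 -> V) : \sum_j F j = F o0 + F o1 + F o2.
Proof.
by rewrite !big_ord_recr big_ord0 /= add0r; congr (F _ + F _ + F _); apply: val_inj.
Qed.

Lemma ord3P (P : 'I_3 -> Prop) : P o0 -> P o1 -> P o2 -> forall i, P i.
Proof.
move=> P0 P1 P2 [[|[|[|//]]] lti].
- by rewrite (_ : Ordinal _ = o0) //; apply: val_inj.
- by rewrite (_ : Ordinal _ = o1) //; apply: val_inj.
- by rewrite (_ : Ordinal _ = o2) //; apply: val_inj.
Qed.

(* The affine coordinates 1, X_0, X_1, indexed by 'I_3, span the degree-one
   part of the filtration. *)
Definition mono (j : 'I_3) : 'X_{1..2} := [multinom (j == i.+1 :> nat : nat) | i < 2].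

Lemma mono0 : mono o0 = 0%MM.
Proof. by apply/mnmP=> i; rewrite !mnmE. Qed.

Lemma mono_lift i : mono (lift ord0 i) = U_(i)%MM.
Proof. by apply/mnmP=> j; rewrite !mnmE lift0 eqSS eq_sym val_eqE. Qed.

(** Distinct unordered pairs of affine coordinates have distinct products, which allows comparing
    coefficients; a finite check on the two exponents. *)
Lemma mono_add_eq j l i i' :
  ((mono j + mono l)%MM == (mono i + mono i')%MM) =
  (j == i) && (l == i') || (j == i') && (l == i).
Proof.
have E2 (m m' : 'X_{1..2}) : (m == m') = (m 0 == m' 0) && (m 1 == m' 1).
  apply/eqP/andP=> [-> //|[/eqP m0 /eqP m1]]; apply/mnmP=> -[[|[|//]] lti].
    by rewrite (_ : Ordinal _ = 0) //; apply: val_inj.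
  by rewrite (_ : Ordinal _ = 1) //; apply: val_inj.
rewrite E2 !mnmDE !mnmE.
by move: j l i i'; do 4!apply: ord3P.
Qed.

Section AffineCoordinates.
Variable k : fieldType.
Local Notation P := {mpoly k[2]}.

Definition aff (j : 'I_3) : P := 'X_[mono j].

Lemma aff0 : aff o0 = 1. Proof. by rewrite /aff mono0 mpolyX0. Qed.
Lemma aff_lift i : aff (lift ord0 i) = 'X_i. Proof. by rewrite /aff mono_lift. Qed.

Lemma aff_coef j i : (aff j)@_(mono i) = (j == i)%:R.
Proof.
have /= := mono_add_eq j o0 i o0; rewrite mono0 !Monoid.mulm1 mcoeffX => ->.
by move: j i; do 2!apply: ord3P.
Qed.

Lemma aff_filt j : aff j \in mfilt 1.
Proof.
rewrite inE msizeX ltnS; move: j; apply: ord3P.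
- by rewrite mono0 mdeg0.
- by rewrite mdegE !big_ord_recr big_ord0 /= !mnmE.
- by rewrite mdegE !big_ord_recr big_ord0 /= !mnmE.
Qed.

Lemma mfilt1E (p : P) : p \in mfilt 1 -> p = \sum_j p@_(mono j) *: aff j.
Proof.
rewrite inE => p2; apply/mpolyP=> m; rewrite raddf_sum /=.
under eq_bigr => j _ do rewrite mcoeffZ mcoeffX.
have [m1|m1] := leqP (mdeg m) 1.
  have [j ->] : exists j, m = mono j.
    move: m1; rewrite leq_eqVlt ltnS leqn0 mdeg_eq0.
    case/orP=> [/mdeg1P[i /eqP ->]|/eqP ->]; last by exists o0; rewrite mono0.
    by exists (lift ord0 i); rewrite mono_lift.
  rewrite (bigD1 j) //= eqxx mulr1 big1 ?addr0 // => i ij.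
  by rewrite -mcoeffX aff_coef (negPf ij) mulr0.
have m_p : m \notin msupp p by apply/msize_mdeg_ge/(leq_trans p2).
rewrite big1 => [|j _]; first by apply/eqP; rewrite mcoeff_eq0.
case: eqP => [jm|]; rewrite ?mulr0 //; move: m1; rewrite -jm => m1.
by have := aff_filt j; rewrite inE msizeX ltnS leqNgt m1.
Qed.

Lemma affM_coef (c : 'I_3 -> 'I_3 -> k) i i' :
  (\sum_j \sum_l c j l *: (aff j * aff l))@_(mono i + mono i') =
  if i == i' then c i i else c i i' + c i' i.
Proof.
rewrite raddf_sum; under eq_bigr => j _.
  rewrite raddf_sum; under eq_bigr => l _ do
    rewrite /= mcoeffZ -mpolyXD mcoeffX mono_add_eq.
  over.
rewrite !sum3; move: i i'; do 2!apply: ord3P;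
  by rewrite /= !(mulr0, mulr1) ?addr0 ?add0r // addrC.
Qed.

(** Structure constants of the bracket on affine coordinates, see [poisson_aff]; index 0 stands for
    the constant 1, whose brackets vanish. *)
Definition omega (j l : 'I_3) : k :=
  ((j == o1) && (l == o2))%:R - ((j == o2) && (l == o1))%:R.

End AffineCoordinates.

Arguments omega : simpl never.

Lemma mpoly_alg_ind (k : fieldType) n (Q : {mpoly k[n]} -> Prop) :
  Q 1 -> (forall c p q, Q p -> Q q -> Q (c *: p + q)) ->
  (forall p q, Q p -> Q q -> Q (p * q)) -> (forall i, Q 'X_i) -> forall p, Q p.
Proof.
move=> Q1 QL QM QX p.
have Q0 : Q 0 by have := QL (-1) 1 1 Q1 Q1; rewrite scaleN1r addNr.
rewrite [p]mpolyE; elim/big_rec: _ => // m q _; apply: QL.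
rewrite mpolyXE_id; elim/big_rec: _ => // i r _; apply: (QM).
by elim: (m i) => [|e IHe]; rewrite ?expr0 // exprS; apply: QM.
Qed.

Lemma bilinear_bilin (k : fieldType) (U V W : lmodType k) (B : {bilinear U -> V -> W}) :
  bilin B.
Proof. by split=> [v c x y|u c x y]; rewrite (linearPl, linearPr). Qed.

Lemma scaler_injl (k : fieldType) (V : lmodType k) (v : V) :
  v != 0 -> injective (fun c : k => c *: v).
Proof.
move=> v0 a b /eqP; rewrite -subr_eq0 -scalerBl scaler_eq0 (negPf v0) orbF.
by rewrite subr_eq0 => /eqP.
Qed.

(** In the application [b] is a translation entry, and the hypothesis pulls it out to the left of a
    2 by 2 minor. *)
Lemma commutator_transfer (R : pzRingType) (a1 a2 b c1 c2 : R) :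
  a1 * (b * c2) - a2 * (b * c1) = b * (a1 * c2 - a2 * c1) ->
  (a1 * b - b * a1) * c2 = (a2 * b - b * a2) * c1.
Proof.
rewrite !mulrBl mulrBr !mulrA => E.
rewrite -[a1 * b * c2](subrK (a2 * b * c1)) E addrAC [X in X + _]addrAC subrr.
by rewrite sub0r addrC.
Qed.

(** Adding p - q = s - r to p + q = r + s gives 2p = 2s. *)
Lemma double_cross (k : fieldType) (V : lmodType k) (p q r s t : V) : 2 != 0 :> k ->
  p - q = t -> r - s = - t -> p + q = r + s -> p = s.
Proof.
move=> two E1 E2 E; apply/eqP; rewrite -subr_eq0.
have : 2 *: (p - s) = 0.
  rewrite scaler_nat mulr2n; apply/eqP; rewrite addrACA -opprD subr_eq0.
  have Ep : p = t + q by rewrite -E1 subrK.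
  have Es : s = r + t by rewrite -[t]opprK -E2 opprB addrC subrK.
  by rewrite {2}Ep addrCA E addrA [t + r]addrC -Es.
by move/eqP; rewrite scaler_eq0 (negPf two).
Qed.

Lemma inverse_cancel (R : pzRingType) (I : finType) (x1 x2 : R) (m1 m2 s : I -> R) :
  (forall i, x1 * m1 i = x2 * m2 i) -> \sum_i m1 i * s i = 1 ->
  \sum_i m2 i * s i = 0 -> x1 = 0.
Proof.
move=> xm m1s m2s; rewrite -[x1]mulr1 -m1s mulr_sumr.
under eq_bigr => i _ do rewrite mulrA xm -mulrA.
by rewrite -mulr_sumr m2s mulr0.
Qed.

(** * Commutation relations between the matrix coefficients *)

Section Action.
Variables (k : fieldType) (H : finHopfType k).
Local Notation P := {mpoly k[2]}.
Variables (br : {bilinear P -> P -> P}) (act : {bilinear H -> P -> P}).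
Hypothesis two_neq0 : 2 != 0 :> k.
Hypothesis brP : is_poisson br.
Hypothesis br_nontrivial : exists a b, br a b != 0.
Hypothesis actP : is_module_poisson br act.
Hypothesis act_filt : preserves_filtration act.
Implicit Types (a b c i j l m : 'I_3) (h g : H) (p q : P).

Local Notation y := (aff k).
Local Notation w := (omega k).
Let f : P := br (y o1) (y o2).

Lemma poisson_anti p q : br p q = - br q p.
Proof.
apply/eqP; rewrite -addr_eq0; apply/eqP.
have := poisson_alt brP (p + q); rewrite linearDl !linearDr /=.
by rewrite !(poisson_alt brP) add0r addr0.
Qed.

Lemma poisson1 p : br p 1 = 0.
Proof.
have := poisson_leibniz brP p 1 1; rewrite !mul1r mulr1 => /eqP.
by rewrite -subr_eq0 opprD addNKr oppr_eq0 => /eqP.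
Qed.

Lemma poisson_aff j l : br (y j) (y l) = w j l *: f.
Proof.
rewrite /omega; move: j l; do 2!apply: ord3P;
  rewrite /= ?subr0 ?sub0r ?scale0r ?scale1r ?scaleN1r ?aff0 ?poisson1
    ?(poisson_alt brP) //.
- by rewrite poisson_anti poisson1 oppr0.
- by rewrite poisson_anti poisson1 oppr0.
- by rewrite poisson_anti.
Qed.

(** The bracket is a derivation in each argument, so it would vanish everywhere if it vanished on
    the generators. As polynomials form a domain, [f] can be cancelled below. *)
Lemma bracket_neq0 : f != 0.
Proof.
have [p0 [q0]] := br_nontrivial; apply: contra_neq => f0.
have br_aff j q : br (y j) q = 0.
  elim/mpoly_alg_ind: q => [|c p q p1 q1|p q p1 q1|i].
  - exact: poisson1.
  - by rewrite linearPr /= p1 q1 scaler0 addr0.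
  - by rewrite (poisson_leibniz brP) p1 q1 mul0r mulr0 addr0.
  - by rewrite -aff_lift poisson_aff f0 scaler0.
elim/mpoly_alg_ind: p0 => [|c p q p1 q1|p q p1 q1|i].
- by rewrite poisson_anti poisson1 oppr0.
- by rewrite linearPl /= p1 q1 scaler0 addr0.
- rewrite poisson_anti (poisson_leibniz brP) poisson_anti p1 [br q0 q]poisson_anti q1.
  by rewrite oppr0 mul0r mulr0 addr0 oppr0.
- by rewrite -aff_lift.
Qed.

Definition Mat a j : dual H := dual_of (fun h => (act h (y a))@_(mono j)).

Lemma MatE a j h : ev (Mat a j) h = (act h (y a))@_(mono j).
Proof. by apply: dual_ofE => c x z; rewrite linearPl /= mcoeffD mcoeffZ. Qed.

Lemma act_aff h a : act h (y a) = \sum_j ev (Mat a j) h *: y j.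
Proof.
rewrite [LHS]mfilt1E; last exact/act_filt/aff_filt.
by apply: eq_bigr => j _; rewrite MatE.
Qed.

Lemma act_affM h a b :
  act h (y a * y b) = \sum_j \sum_l ev (Mat a j * Mat b l) h *: (y j * y l).
Proof.
rewrite (hact_mul actP) /sweedler.
apply: (sweedler_sum (B := fun p q => p * q)) => [|x|x]; last 2 first.
- exact: act_aff.
- exact: act_aff.
by split=> [q c p p'|p c q q']; rewrite ?mulrDl ?mulrDr -?scalerAl -?scalerAr.
Qed.

(** Compare the coefficients of y_i^2 in h . (y_a y_b) and h . (y_b y_a). *)
Lemma Mat_col a b i : Mat a i * Mat b i = Mat b i * Mat a i.
Proof.
apply/dualP=> h; have := affM_coef (fun j l => ev (Mat a j * Mat b l) h) i i.
have := affM_coef (fun j l => ev (Mat b j * Mat a l) h) i i.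
by rewrite -!act_affM mulrC eqxx => -> ->.
Qed.

(** The same comparison for the mixed monomial y_i y_i'. *)
Lemma Mat_cross a b i i' : i != i' ->
  Mat a i * Mat b i' + Mat a i' * Mat b i = Mat b i * Mat a i' + Mat b i' * Mat a i.
Proof.
move=> ii'; apply/dualP=> h.
have := affM_coef (fun j l => ev (Mat a j * Mat b l) h) i i'.
have := affM_coef (fun j l => ev (Mat b j * Mat a l) h) i i'.
by rewrite -!act_affM mulrC (negPf ii') -!dualD => -> ->.
Qed.

Lemma act_bracket_aff h a b :
  act h (br (y a) (y b)) = ev (\sum_j \sum_l w j l *: (Mat a j * Mat b l)) h *: f.
Proof.
rewrite (hact_bracket actP) /sweedler.
rewrite (sweedler_sum (p := y) (u := Mat a) (q := y) (v := Mat b)).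
- rewrite dual_sum scaler_suml; apply: eq_bigr => j _.
  rewrite dual_sum scaler_suml; apply: eq_bigr => l _.
  by rewrite poisson_aff dualZ scalerA mulrC.
- exact: bilinear_bilin.
- by move=> x; apply: act_aff.
- by move=> x; apply: act_aff.
Qed.

(** The determinant of the linear part, whose entries are not yet known to commute; it is the
    coefficient by which [H] acts on [f]. *)
Let D : dual H := \sum_j \sum_l w j l *: (Mat o1 j * Mat o2 l).

Lemma act_f h : act h f = ev D h *: f.
Proof. exact: act_bracket_aff. Qed.

Lemma Mat_bracket a b :
  \sum_j \sum_l w j l *: (Mat a j * Mat b l) = w a b *: D.
Proof.
apply/dualP=> h; have := act_bracket_aff h a b.
rewrite poisson_aff linearZr act_f /= scalerA => /esym/(scaler_injl bracket_neq0).
by rewrite dualZ.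
Qed.

Lemma sum_omega (V : lmodType k) (F : 'I_3 -> 'I_3 -> V) :
  \sum_j \sum_l w j l *: F j l = F o1 o2 - F o2 o1.
Proof.
rewrite !sum3 /omega /= !subr0 !sub0r !scale0r scale1r scaleN1r.
by rewrite !(addr0, add0r).
Qed.

Lemma act_fM h b : act h (f * y b) = \sum_m ev (D * Mat b m) h *: (f * y m).
Proof.
rewrite (hact_mul actP) /sweedler.
rewrite (sweedler_sum (B := fun p q => p * q) (I := 'I_1) (p := fun=> f)
  (u := fun=> D) (q := y) (v := Mat b)) ?big_ord1 // => [|x|x].
- by split=> [q c p p'|p c q q']; rewrite ?mulrDl ?mulrDr -?scalerAl -?scalerAr.
- by rewrite big_ord1 act_f.
- exact: act_aff.
Qed.

(** Expand the action on f y_b and on y_b f, cancel [f], and compare coefficients. *)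
Lemma D_comm b m : D * Mat b m = Mat b m * D.
Proof.
have E2 h : act h (y b * f) = \sum_m ev (Mat b m * D) h *: (y m * f).
  rewrite (hact_mul actP) /sweedler.
  rewrite (sweedler_sum (B := fun p q => p * q) (J := 'I_1) (p := y)
    (u := Mat b) (q := fun=> f) (v := fun=> D)).
  - by apply: eq_bigr => j _; rewrite big_ord1.
  - by split=> [q c p p'|p c q q']; rewrite ?mulrDl ?mulrDr -?scalerAl -?scalerAr.
  - by move=> x; apply: act_aff.
  - by move=> x; rewrite big_ord1 act_f.
apply/dualP=> h; have := E2 h; rewrite mulrC act_fM.
under eq_bigr => j _ do rewrite scalerAr.
under [in RHS]eq_bigr => j _ do rewrite mulrC scalerAr.
rewrite -!mulr_sumr => /(mulfI bracket_neq0)/(congr1 (mcoeff (mono m))).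
rewrite !raddf_sum /= (bigD1 m) //= [in RHS](bigD1 m) //=.
rewrite !mcoeffZ aff_coef eqxx !mulr1 !big1 ?addr0 // => j jm;
  by rewrite mcoeffZ aff_coef (negPf jm) mulr0.
Qed.

Lemma aff_sum_coef (c : 'I_3 -> k) j : (\sum_m c m *: y m)@_(mono j) = c j.
Proof.
rewrite raddf_sum (bigD1 j) //= mcoeffZ aff_coef eqxx mulr1.
by rewrite big1 ?addr0 // => l lj; rewrite mcoeffZ aff_coef (negPf lj) mulr0.
Qed.

Lemma bracket_affM j l m :
  br (y j) (y l * y m) = f * (w j l *: y m + w j m *: y l).
Proof.
rewrite (poisson_leibniz brP) !poisson_aff mulrDr -!scalerAr -!scalerAl.
by congr (_ + _ *: _); rewrite mulrC.
Qed.

(** Compute h . {y_a, y_b y_c} before and after expanding the bracket, cancel [f], and compare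
    constant coefficients. The terms with [w a b] agree by [Mat_bracket] and drop out. *)
Lemma Mat_bracketM a b c :
  \sum_j \sum_m w j m *: (Mat a j * (Mat b o0 * Mat c m)) = w a c *: (D * Mat b o0).
Proof.
apply/dualP=> h.
have E1 : act h (br (y a) (y b * y c)) =
    \sum_j \sum_l \sum_m ev (Mat a j * (Mat b l * Mat c m)) h *: br (y j) (y l * y m).
  rewrite (hact_bracket actP) /sweedler.
  rewrite (sweedler_sum (p := y) (u := Mat a) (J := ('I_3 * 'I_3)%type)
    (q := fun z => y z.1 * y z.2) (v := fun z => Mat b z.1 * Mat c z.2)) => [|||x].
  - apply: eq_bigr => j _; rewrite pair_bigA.
    by apply: eq_bigr.
  - exact: bilinear_bilin.
  - by move=> x; apply: act_aff.
  - by rewrite act_affM pair_bigA.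
have E2 : act h (br (y a) (y b * y c)) =
    f * \sum_m ev (w a b *: (D * Mat c m) + w a c *: (D * Mat b m)) h *: y m.
  rewrite bracket_affM mulrDr -!scalerAr linearPr linearZr !act_fM /= mulr_sumr.
  rewrite !scaler_sumr -big_split; apply: eq_bigr => m _ /=.
  by rewrite dualD !dualZ -scalerAr [RHS]scalerDl !scalerA.
move: E1; rewrite E2.
under [in RHS]eq_bigr => j _ do under eq_bigr => l _ do
  (under eq_bigr => m _ do rewrite bracket_affM scalerAr; rewrite -mulr_sumr).
under [in RHS]eq_bigr => j _ do rewrite -mulr_sumr.
rewrite -mulr_sumr => /(mulfI bracket_neq0)/(congr1 (mcoeff (mono o0))).
rewrite aff_sum_coef.
(* Only [m = o0] contributes to the first summand and only [l = o0] to the second, since y_0 = 1 is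
   the only affine coordinate with a constant term. *)
have -> : (\sum_i \sum_l \sum_m ev (Mat a i * (Mat b l * Mat c m)) h *:
    (w i l *: y m + w i m *: y l))@_(mono o0) =
  ev (\sum_i \sum_l w i l *: (Mat a i * Mat b l) * Mat c o0 +
      \sum_i \sum_m w i m *: (Mat a i * (Mat b o0 * Mat c m))) h.
  rewrite raddf_sum dualD !dual_sum -big_split; apply: eq_bigr => i _.
  rewrite [RHS]/=.
  have EC l m : (w i l *: y m + w i m *: y l)@_(mono o0) =
      w i l * (m == o0)%:R + w i m * (l == o0)%:R.
    by rewrite mcoeffD !mcoeffZ !aff_coef.
  have EL l : (\sum_m ev (Mat a i * (Mat b l * Mat c m)) h *:
      (w i l *: y m + w i m *: y l))@_(mono o0) =
    ev (Mat a i * (Mat b l * Mat c o0)) h * w i l +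
    \sum_m ev (Mat a i * (Mat b l * Mat c m)) h * (w i m * (l == o0)%:R).
    rewrite raddf_sum.
    transitivity (\sum_m (
        ev (Mat a i * (Mat b l * Mat c m)) h * (w i l * (m == o0)%:R) +
        ev (Mat a i * (Mat b l * Mat c m)) h * (w i m * (l == o0)%:R))).
      by apply: eq_bigr => m _; rewrite /= mcoeffZ EC mulrDr.
    rewrite big_split (bigD1 o0) //= mulr1; congr (_ + _).
    by rewrite big1 ?addr0 // => m /negPf ->; rewrite !mulr0.
  rewrite raddf_sum (eq_bigr _ (fun l _ => EL l)).
  rewrite big_split !dual_sum /=; congr (_ + _).
    by apply: eq_bigr => l _; rewrite -scalerAl dualZ -mulrA mulrC.
  rewrite (bigD1 o0) //= [X in _ + X]big1 ?addr0 => [|l /negPf l0]; last first.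
    by rewrite big1 // => m _; rewrite l0 !mulr0.
  by apply: eq_bigr => m _; rewrite mulr1 dualZ mulrC.
under eq_bigr => i _ do rewrite -mulr_suml.
rewrite -mulr_suml Mat_bracket -scalerAl !dualD => /addrI /esym.
exact.
Qed.

(** As [h] acts first and its coefficients come out as scalars, [Mat] reverses products. *)
Lemma MatM a j g h : ev (Mat a j) (g * h) = \sum_l ev (Mat a l) h * ev (Mat l j) g.
Proof.
rewrite MatE (hact_M actP) act_aff linear_sumr raddf_sum; apply: eq_bigr => l _.
by rewrite linearZr /= mcoeffZ -MatE.
Qed.

Definition Mat_inv d c : dual H := dual_of (fun h => ev (Mat d c) (antipode h)).

(** Evaluate [Mat] at h_1 S(h_2), which is a scalar; the reversal in [MatM] puts the factors in this
    order. *)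
Lemma Mat_invK d j : \sum_c Mat c j * Mat_inv d c = (d == j)%:R *: 1.
Proof.
have SE c h : ev (Mat_inv d c) h = ev (Mat d c) (antipode h).
  by apply: dual_ofE => e x z; rewrite !linearP.
apply/dualP=> h; rewrite dualZ dual1E dual_sum.
transitivity (tlift (fun x z => ev (Mat d j) (x * antipode z) : k^o) (comul h)).
  under eq_bigr => c _ do rewrite dualM.
  rewrite -(tlift_sum (W := k^o)); apply: (@eq_tlift _ _ _ k^o) => x z.
  by rewrite MatM; apply: eq_bigr => c _; rewrite SE mulrC.
rewrite -(tlift_comp (W' := k^o) _ _ (f := ev (Mat d j))); last exact: evL.
by rewrite antipoder linearZ /= MatE (hact_1 actP) aff_coef mulrC.
Qed.

(* Comparing the constant coefficients of [h . {u_a, u_b u_c}] gives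
   [x_1 * Mat c 2 = x_2 * Mat c 1] for the commutators [x_j] of [Mat a j] with
   the translation part [Mat b 0]; the matrix [Mat] is invertible. *)
Lemma Mat_translation a b j : Mat a j * Mat b o0 = Mat b o0 * Mat a j.
Proof.
pose x i := Mat a i * Mat b o0 - Mat b o0 * Mat a i.
have xM c : x o1 * Mat c o2 = x o2 * Mat c o1.
  have := Mat_bracketM a b c; rewrite sum_omega D_comm scalerAr -Mat_bracket sum_omega.
  exact: commutator_transfer.
have x1 : x o1 = 0.
  (* Row 2 of the inverse pairs to 1 with column 2 of [Mat] and to 0 with column 1. *)
  apply: (inverse_cancel (s := Mat_inv o2) xM).
    by rewrite (Mat_invK o2 o2) scale1r.
  by rewrite (Mat_invK o2 o1) scale0r.
have x2 : x o2 = 0.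
  apply: (inverse_cancel (s := Mat_inv o1) (fun c => esym (xM c))).
    by rewrite (Mat_invK o1 o1) scale1r.
  by rewrite (Mat_invK o1 o2) scale0r.
by move: j; apply: ord3P; [exact: Mat_col | exact: (subr0_eq x1) | exact: (subr0_eq x2)].
Qed.

(** The bracket controls the antisymmetric combinations of these products and commutativity of the
    polynomials the symmetric ones; dividing by 2 separates them. *)
Lemma Mat_comm12 a b : Mat a o1 * Mat b o2 = Mat b o2 * Mat a o1.
Proof.
have := Mat_bracket a b; have := Mat_bracket b a; rewrite !sum_omega.
have -> : w b a = - w a b by rewrite /omega opprB andbC [(b == o2) && _]andbC.
rewrite scaleNr => Eba Eab.
exact: double_cross two_neq0 Eab Eba (@Mat_cross a b o1 o2 isT).
Qed.

Lemma Mat_comm a b i j : Mat a i * Mat b j = Mat b j * Mat a i.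
Proof.
move: i j; apply: ord3P.
- by move=> j; exact: (esym (Mat_translation b a j)).
- by apply: ord3P; [exact: Mat_translation | exact: Mat_col | exact: Mat_comm12].
by apply: ord3P; [exact: Mat_translation | exact: (esym (Mat_comm12 b a)) | exact: Mat_col].
Qed.

End Action.

(** * Translations in the dual, and duals of quotients *)

Section Shifts.
Variables (k : fieldType) (H : finHopfType k).
Implicit Types (u v : dual H) (g : H).

Lemma rtrans_is_linear g : linear (@rtrans k H g).
Proof. by move=> c u v; apply/dualP=> h; rewrite !(rtransE, dualD, dualZ). Qed.

Lemma ltrans_is_linear g : linear (@ltrans k H g).
Proof. by move=> c u v; apply/dualP=> h; rewrite !(ltransE, dualD, dualZ). Qed.

Lemma rtrans1 g : rtrans g 1 = counit g *: 1.
Proof. by apply/dualP=> h; rewrite rtransE dualZ !dual1E counitM mulrC. Qed.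

Lemma ltrans1 g : ltrans g 1 = counit g *: 1.
Proof. by apply/dualP=> h; rewrite ltransE dualZ !dual1E counitM. Qed.

Lemma rtransM g u v :
  rtrans g (u * v) = tlift (fun a b => rtrans a u * rtrans b v) (comul g).
Proof.
apply/dualP=> h; rewrite rtransE dualM (ev_comulM _ _ (ev_bilin u v)).
rewrite (tlift_comp (W' := k^o) _ _ (f := fun w => ev w h)); last first.
  by move=> c x y; rewrite dualD dualZ.
rewrite tlift_exchange; apply: (@eq_tlift _ _ _ k^o) => a b; rewrite dualM.
by apply: (@eq_tlift _ _ _ k^o) => x y; rewrite !rtransE.
Qed.

Lemma ltransM g u v :
  ltrans g (u * v) = tlift (fun a b => ltrans a u * ltrans b v) (comul g).
Proof.
apply/dualP=> h; rewrite ltransE dualM (ev_comulM _ _ (ev_bilin u v)).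
rewrite (tlift_comp (W' := k^o) _ _ (f := fun w => ev w h)); last first.
  by move=> c x y; rewrite dualD dualZ.
apply: (@eq_tlift _ _ _ k^o) => a b; rewrite dualM.
by apply: (@eq_tlift _ _ _ k^o) => x y; rewrite !ltransE.
Qed.

End Shifts.

(** A form on the quotient pulls back to a form vanishing on [ann A], which lies in [A] by
    [ann_ann]; pulling back respects products. *)
Lemma hquot_dual_comm (k : fieldType) (H : finHopfType k) (I : hopf_ideal H)
    (A : {vspace dual H}) : I = ann A :> {vspace H} ->
  {in A &, commutative *%R} -> commutative (@GRing.mul (dual (hquot I))).
Proof.
move=> IA AC.
pose pull (u : dual (hquot I)) : dual H := dual_of (fun h => ev u (hquot_pi I h)).
have pullE u h : ev (pull u) h = ev u (hquot_pi I h).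
  by apply: dual_ofE => c x y; rewrite !linearP.
have pullA u : pull u \in A.
  by apply: ann_ann => h; rewrite -IA -hquot_pi_eq0 pullE => /eqP ->; rewrite linear0.
have evM u v h : ev (u * v) (hquot_pi I h) = ev (pull u * pull v) h.
  rewrite !dualM (hquot_lift_pi (W := k^o)); last exact: ev_bilin.
  by apply: (@eq_tlift _ _ _ k^o) => a b; rewrite !pullE.
move=> u v; apply/dualP; apply: hquotW => h.
by rewrite !evM AC.
Qed.

(** * The algebra generated by the matrix coefficients *)

Section CoefficientAlgebra.
Variables (k : fieldType) (H : finHopfType k).
Local Notation P := {mpoly k[2]}.
Variables (br : {bilinear P -> P -> P}) (act : {bilinear H -> P -> P}).
Hypothesis actP : is_module_poisson br act.
Hypothesis act_filt : preserves_filtration act.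
Implicit Types (u v : dual H) (g h : H) (p q : P).

Definition coef_alg : {aspace dual H} :=
  (<< <<[seq Mat act z.1 z.2 | z : ('I_3 * 'I_3)%type]>> >>)%AS.

Lemma Mat_coef_alg a j : Mat act a j \in coef_alg.
Proof.
apply: (subvP (sub_agenv _)); apply: memv_span.
by apply/imageP; exists (a, j).
Qed.

Lemma one_coef_alg : 1 \in coef_alg.
Proof. by apply: (subvP (sub1_agenv _)); apply: memv_line. Qed.

Lemma coef_alg_ind (Q : dual H -> Prop) : Q 1 ->
  (forall c u v, Q u -> Q v -> Q (c *: u + v)) -> (forall u v, Q u -> Q v -> Q (u * v)) ->
  (forall a j, Q (Mat act a j)) -> forall u, u \in coef_alg -> Q u.
Proof.
by move=> Q1 QL QM QX; apply: agenv_ind => // _ /imageP[z _ ->].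
Qed.

(** By [MatM], a right translate of an entry is a combination of entries in the same column; a
    translate of a product expands through [comul g]. *)
Lemma coef_alg_rtrans g u : u \in coef_alg -> rtrans g u \in coef_alg.
Proof.
(* The element [g] is generalized because the product case translates the factors by other
   elements. *)
move=> uA; move: u uA g; apply: coef_alg_ind => [g|c u v u1 v1 g|u v u1 v1 g|a j g].
- by rewrite rtrans1 memvZ ?one_coef_alg.
- by rewrite rtrans_is_linear memvD ?memvZ.
- by rewrite rtransM; apply: tlift_mem => x y; apply: memvM.
rewrite (_ : rtrans g _ = \sum_l ev (Mat act a l) g *: Mat act l j).
  by apply: memv_suml => l _; rewrite memvZ ?Mat_coef_alg.
apply/dualP=> h; rewrite rtransE (MatM actP act_filt) dual_sum.
by apply: eq_bigr => l _; rewrite dualZ.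
Qed.

Lemma coef_alg_ltrans g u : u \in coef_alg -> ltrans g u \in coef_alg.
Proof.
move=> uA; move: u uA g; apply: coef_alg_ind => [g|c u v u1 v1 g|u v u1 v1 g|a j g].
- by rewrite ltrans1 memvZ ?one_coef_alg.
- by rewrite ltrans_is_linear memvD ?memvZ.
- by rewrite ltransM; apply: tlift_mem => x y; apply: memvM.
rewrite (_ : ltrans g _ = \sum_l ev (Mat act l j) g *: Mat act a l).
  by apply: memv_suml => l _; rewrite memvZ ?Mat_coef_alg.
apply/dualP=> h; rewrite ltransE (MatM actP act_filt) dual_sum.
by apply: eq_bigr => l _; rewrite dualZ mulrC.
Qed.

Definition coef_fun p m : dual H := dual_of (fun h => (act h p)@_m).

Lemma coef_funE p m h : ev (coef_fun p m) h = (act h p)@_m.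
Proof. by apply: dual_ofE => c x y; rewrite linearPl /= mcoeffD mcoeffZ. Qed.

(** The variables generate the polynomial algebra, so every coefficient of the action is a
    polynomial in the entries of [Mat]. *)
Lemma coef_fun_alg p m : coef_fun p m \in coef_alg.
Proof.
elim/mpoly_alg_ind: p m => [|c p q p1 q1|p q p1 q1|i] m.
- rewrite (_ : coef_fun _ _ = (1 : P)@_m *: 1) ?memvZ ?one_coef_alg //.
  apply/dualP=> h; rewrite coef_funE (hact_unit actP) dualZ dual1E mcoeffZ.
  by rewrite mulrC.
- rewrite (_ : coef_fun _ _ = c *: coef_fun p m + coef_fun q m) ?memvD ?memvZ //.
  by apply/dualP=> h; rewrite dualD dualZ !coef_funE linearPr /= mcoeffD mcoeffZ.
(* Both parts of a decomposition of [m] have degree less than [d], so a finite type indexes all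
   decompositions. *)
- pose d := (mdeg m).+1.
  rewrite (_ : coef_fun _ _ = \sum_(z : 'X_{1..2 < d, d} | m == (z.1 + z.2)%MM)
    coef_fun p z.1 * coef_fun q z.2).
    by apply: memv_suml => z _; apply: memvM.
  apply/dualP=> h; rewrite coef_funE (hact_mul actP) /sweedler dual_sum.
  rewrite (tlift_comp (W' := k^o) _ _ (f := mcoeff m)); last first.
    by move=> c x y; rewrite mcoeffD mcoeffZ.
  (* The side condition moves inside the terms, so that the sum runs over the whole finite type and
     passes through [tlift]. *)
  rewrite big_mkcond; under [in RHS]eq_bigr => z _.
    rewrite (_ : (if _ then _ else _) = tlift (fun a b => if m == (z.1 + z.2)%MM then
      ev (coef_fun p z.1) a * ev (coef_fun q z.2) b : k^o else 0) (comul h)); last first.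
      case: ifP => _; first by rewrite dualM.
      by rewrite /tlift big1 // => i _; rewrite big1 // => j _; rewrite scaler0.
    over.
  rewrite -(tlift_sum (W := k^o)); apply: (@eq_tlift _ _ _ k^o) => a b.
  rewrite mcoeffM big_mkcond; apply: eq_bigr => z _.
  by rewrite !coef_funE.
rewrite (_ : coef_fun _ _ = \sum_j (aff k j)@_m *: Mat act (lift ord0 i) j).
  by apply: memv_suml => j _; rewrite memvZ ?Mat_coef_alg.
apply/dualP=> h; rewrite coef_funE -aff_lift (act_aff act_filt) raddf_sum dual_sum.
by apply: eq_bigr => j _; rewrite /= mcoeffZ dualZ mulrC.
Qed.

Lemma ann_coef_alg h p : h \in ann coef_alg -> act h p = 0.
Proof.
move=> /annP h0; apply/mpolyP=> m.
by rewrite mcoeff0 -coef_funE h0 ?coef_fun_alg.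
Qed.

Lemma coef_alg_comm : 2 != 0 :> k -> is_poisson br -> (exists a b, br a b != 0) ->
  {in coef_alg &, commutative *%R}.
Proof.
move=> two brP br0 u v uA vA.
move: u uA; apply: coef_alg_ind => [|c x y xv yv|x y xv yv|a i].
- by rewrite mul1r mulr1.
- by rewrite mulrDl mulrDr -scalerAl -scalerAr xv yv.
- by rewrite mulrA -xv -!mulrA yv.
move: v vA; apply: coef_alg_ind => [|c x y xv yv|x y xv yv|b j].
- by rewrite mul1r mulr1.
- by rewrite mulrDl mulrDr -scalerAl -scalerAr xv yv.
- by rewrite mulrA xv -!mulrA yv.
exact: (Mat_comm two brP br0 actP act_filt).
Qed.

End CoefficientAlgebra.

Theorem corollary3p9 (k : closedFieldType) (char0 : [pchar k] =i pred0)
    (br : {bilinear {mpoly k[2]} -> {mpoly k[2]} -> {mpoly k[2]}})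
    (br_poisson : is_poisson br)
    (br_quadratic : filtered_quadratic br)
    (br_nontrivial : exists a b, br a b != 0)
    (H : finHopfType k)
    (act : {bilinear H -> {mpoly k[2]} -> {mpoly k[2]}})
    (act_poisson : is_module_poisson br act)
    (act_filtration : preserves_filtration act) :
  factors_through_group_algebra act.
Proof.
have two : 2 != 0 :> k by rewrite ((pcharf0P k).1 char0).
have shA := coef_alg_rtrans act_poisson act_filtration.
have lshA := coef_alg_ltrans act_poisson act_filtration.
have [I IA] := ann_hopf_ideal (one_coef_alg act) shA lshA.
exists I; split=> [h a|]; first by rewrite IA; apply: (ann_coef_alg act_poisson).
apply: (cocommutative_group_alg char0); apply: (hquot_dual_comm IA).
exact: (coef_alg_comm act_poisson act_filtration two br_poisson br_nontrivial).
Qed.
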